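(* Let $X$ be a Peano continuum with a compatible metric $d$, and suppose $H_1(X)$ has cardinality $< 2^{\aleph_0}$. Then there exist $\epsilon>0$ and $N\in\omega$ such that every loop $l$ in $X$ of diameter less than $\epsilon$ has commutator length at most $N$, where the commutator length is computed for $[l]$ in the group $\pi_1(X, l(0))$.
   Context: A Peano continuum is a path connected, locally path connected, compact metrizable space. For a group $G$ and $g\in G$, the commutator length $\mathrm{cl}(g)$ is the smallest $n$ such that $g$ is a product of $n$ commutators, and $\mathrm{cl}(g)=\infty$ if $g\notin[G,G]$. The diameter of a loop is the diameter of its image. *)

(* Defs.v *)
From HB Require Import structures.
From mathcomp Require Import all_boot all_order all_algebra.
From mathcomp Require Import all_classical all_reals topology num_topology normedtype.
Set Implicit Arguments. Unset Strict Implicit. Unset Printing Implicit Defensive.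
Import Order.TTheory GRing.Theory Num.Theory.
Import numFieldTopology.Exports numFieldNormedType.Exports.
Local Open Scope classical_set_scope.
Local Open Scope ring_scope.

Section Defs.
Context {R : realType} {X : topologicalType}.

Definition unit_I : set R := [set t | 0 <= t <= 1].
Definition unit_sq : set (R * R) := [set p | unit_I p.1 /\ unit_I p.2].
(** Standard 2-simplex, parametrized: (u,v) <-> (1-u-v) e0 + u e1 + v e2. *)
Definition simplex2 : set (R * R) := [set p | 0 <= p.1 /\ 0 <= p.2 /\ p.1 + p.2 <= 1].

(** A path: a continuous map [0,1] -> X (values outside [0,1] irrelevant). *)
Definition is_path (f : R -> X) : Prop := {within unit_I, continuous f}.

Definition path_in (U : set X) (f : R -> X) (x y : X) : Prop :=
  is_path f /\ f 0 = x /\ f 1 = y /\ (forall t, unit_I t -> U (f t)).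

Definition is_metric (d : X -> X -> R) : Prop :=
  (forall x y, 0 <= d x y) /\ (forall x y, d x y = 0 <-> x = y) /\
  (forall x y, d x y = d y x) /\ (forall x y z, d x z <= d x y + d y z).

Definition compatible_metric (d : X -> X -> R) : Prop :=
  is_metric d /\
  forall A : set X, open A <->
    (forall x, A x -> exists2 e : R, 0 < e & [set y | d x y < e] `<=` A).

Definition path_connected_set (U : set X) : Prop :=
  forall x y, U x -> U y -> exists f, path_in U f x y.

Definition locally_path_connected : Prop :=
  forall (x : X) (U : set X), nbhs x U ->
    exists V : set X, [/\ open V, V x, V `<=` U & path_connected_set V].

(** Peano continuum: path connected, locally path connected, compact
    (metrizability is provided separately by the compatible metric d). *)
Definition peano_continuum : Prop :=
  [/\ compact [set: X], path_connected_set [set: X] & locally_path_connected].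

Definition loop_diam (d : X -> X -> R) (l : R -> X) : R :=
  sup [set d (l s) (l t) | s in unit_I & t in unit_I].

Definition path_concat (f g : R -> X) : R -> X :=
  fun s => if s <= 2^-1 then f (2 * s) else g (2 * s - 1).
Definition path_rev (f : R -> X) : R -> X := fun s => f (1 - s).
Definition const_path (x : X) : R -> X := fun _ => x.

Definition path_homotopic (f g : R -> X) : Prop :=
  exists H : R * R -> X,
    [/\ {within unit_sq, continuous H},
        (forall s, unit_I s -> H (s, 0) = f s /\ H (s, 1) = g s)
      & (forall t, unit_I t -> H (0, t) = f 0 /\ H (1, t) = f 1)].

Definition loop_comm (a b : R -> X) : R -> X :=
  path_concat a (path_concat b (path_concat (path_rev a) (path_rev b))).
Definition comm_prod (x : X) (a b : nat -> R -> X) (n : nat) : R -> X :=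
  foldr (fun i acc => path_concat (loop_comm (a i) (b i)) acc)
        (const_path x) (iota 0 n).

Definition comm_length_le (l : R -> X) (N : nat) : Prop :=
  exists n : nat, (n <= N)%N /\ exists a b : nat -> R -> X,
    (forall i, is_path (a i) /\ a i 0 = l 0 /\ a i 1 = l 0) /\
    (forall i, is_path (b i) /\ b i 0 = l 0 /\ b i 1 = l 0) /\
    path_homotopic l (comm_prod (l 0) a b n).

(** Singular homology H_1(X; Z).  Singular 1-simplices are continuous maps on
    [0,1] (vertex e0 at 0, e1 at 1), 2-simplices continuous maps on simplex2;
    simplices are identified when they agree on their domain.  Chains are
    finite formal Z-combinations, represented by lists. *)
Definition chain1 := seq (int * (R -> X)).
Definition chain2 := seq (int * (R * R -> X)).

Definition agree_on_I (p q : R -> X) : Prop := forall t, unit_I t -> p t = q t.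

Definition coef1 (c : chain1) (p : R -> X) : int :=
  \sum_(e <- c) (if `[< agree_on_I e.2 p >] then e.1 else 0).

Definition is_chain1 (c : chain1) : Prop := forall e, e \in c -> is_path e.2.
Definition is_chain2 (w : chain2) : Prop :=
  forall e, e \in w -> {within simplex2, continuous e.2}.

Definition bd1_coef (c : chain1) (x : X) : int :=
  \sum_(e <- c) (e.1 * ((`[< e.2 1 = x >] : int) - (`[< e.2 0 = x >] : int))).

Definition is_cycle1 (c : chain1) : Prop :=
  is_chain1 c /\ forall x, bd1_coef c x = 0.

Definition face0 (s : R * R -> X) : R -> X := fun t => s (1 - t, t).
Definition face1 (s : R * R -> X) : R -> X := fun t => s (0, t).
Definition face2 (s : R * R -> X) : R -> X := fun t => s (t, 0).

Definition bd2 (w : chain2) : chain1 :=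
  flatten [seq [:: (e.1, face0 e.2); (- e.1, face1 e.2); (e.1, face2 e.2)]
          | e <- w].

Definition homologous (z1 z2 : chain1) : Prop :=
  exists w : chain2, is_chain2 w /\
    forall p : R -> X, coef1 z1 p - coef1 z2 p = coef1 (bd2 w) p.

Definition H1_card_lt_continuum : Prop :=
  ~ exists f : (nat -> bool) -> chain1,
      (forall a, is_cycle1 (f a)) /\
      (forall a b, homologous (f a) (f b) -> a = b).

End Defs.

(* Main.v *)
(** By compactness and local path connectedness, if the conclusion fails there is
    a point [x] with loops [l n] at [x] that shrink to [x] and have commutator
    length larger than [n]. For [a] in the Cantor space let [L a] be the infinite
    concatenation of the loops [l n] with [a n] true. By the
    Hurewicz theorem, [L a] and [L b] are homologous only if [L a * (L b)^-1] is a
    product of finitely many commutators, and the relation [E n] that [n]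
    commutators suffice is analytic: its witnesses are homotopies, which form a
    separable complete space. If the union of the [E n] is meager, Mycielski's
    theorem gives a perfect set of pairwise non-homologous cycles [L a], against
    the bound on the cardinality of [H_1]. Otherwise some [E n] is comeager in a
    basic open set, so there are [m > 2 n] and [a], [a'], [b] such that [a] and [a']
    differ exactly at [m] and both pairs [(a, b)], [(a', b)] are in [E n]. Then
    [L a * (L a')^-1] has commutator length at most [2 n] and is conjugate to [l m]
    or its inverse, a contradiction. *)

Require Import Defs.
From HB Require Import structures.
From mathcomp Require Import all_boot all_order all_algebra.
From mathcomp Require Import generic_quotient ring lra.
From mathcomp Require Import all_classical all_reals topology num_topology normedtype.
Import Order.TTheory GRing.Theory Num.Theory.
Import numFieldTopology.Exports numFieldNormedType.Exports.
Local Open Scope classical_set_scope.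
Local Open Scope ring_scope.

Set Implicit Arguments. Unset Strict Implicit. Unset Printing Implicit Defensive.

(** * Baire category in the square of the Cantor space *)

(** The relation that [n] commutators suffice is not visibly closed: when pairs converge, the
    witnessing homotopies may fail to do so. Hence the category argument runs on a tree. A branch
    confines the homotopy to shrinking balls of the uniform distance, whose centres come from a
    countable supply of step functions, so homotopies along a branch are Cauchy. Their limit again
    ends in a product of [n] commutators, since each letter occupies a fixed subinterval of the
    product. The first entry of a branch is [n] and the root is the union over all [n], so one
    argument both selects [n] and makes its relation comeager on a basic set. Open sets are handled
    through pairs of finite strings. These are countable in number, so a demand for each pair of
    strings and each tree node still amounts to countably many dense sets. Changing a single
    coordinate [m] of [a] gives a bound [2 n] independent of [m]: the loops before [m] become a
    conjugator, those after [m] cancel, and only [l m] is left. *)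

Definition cantor := nat -> bool.

Definition restr (a : cantor) (n : nat) : seq bool := mkseq a n.

(** Cohen conditions: a pair of finite strings stands for a basic clopen set of
    pairs of points of the Cantor space. *)
Definition cond := (seq bool * seq bool)%type.

Definition ext (c c' : cond) : Prop := prefix c.1 c'.1 /\ prefix c.2 c'.2.

Definition in_cond (c : cond) (p : cantor * cantor) : Prop :=
  restr p.1 (size c.1) = c.1 /\ restr p.2 (size c.2) = c.2.

Definition dense_cond (D : cond -> Prop) : Prop :=
  forall c, exists c', ext c c' /\ D c'.

Definition meets (D : cond -> Prop) (p : cantor * cantor) : Prop :=
  exists c, in_cond c p /\ D c.

(** A dense family of conditions stands for the dense open union of its basic clopen sets. Density
    is asked everywhere, also outside [c]; a family dense only below [c] becomes such a family by
    adding the conditions incompatible with [c]. *)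
Definition meager_in (A : cantor * cantor -> Prop) (c : cond) : Prop :=
  exists D : nat -> cond -> Prop, (forall k, dense_cond (D k)) /\
    forall p, in_cond c p -> (forall k, meets (D k) p) -> ~ A p.

Lemma ext_refl c : ext c c.
Proof. by split; exact: prefix_refl. Qed.

Lemma ext_trans c1 c2 c3 : ext c1 c2 -> ext c2 c3 -> ext c1 c3.
Proof. by move=> [a b] [a' b']; split; [exact: prefix_trans a a'|exact: prefix_trans b b']. Qed.

Lemma size_restr a n : size (restr a n) = n.
Proof. exact: size_mkseq. Qed.

Lemma nth_restr a n i : (i < n)%N -> nth false (restr a n) i = a i.
Proof. exact: nth_mkseq. Qed.

Lemma restrP (a : cantor) s :
  restr a (size s) = s <-> (forall i, (i < size s)%N -> nth false s i = a i).
Proof.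
split=> [<- i|H]; first by rewrite size_restr => /nth_restr.
apply: (@eq_from_nth _ false); rewrite size_restr// => i Hi.
by rewrite nth_restr// H.
Qed.

Lemma restr_take a m n : (m <= n)%N -> take m (restr a n) = restr a m.
Proof. by move=> mn; rewrite /restr -map_take take_iota (minn_idPl mn). Qed.

Lemma prefix_restr a m n : (m <= n)%N -> prefix (restr a m) (restr a n).
Proof. by move=> mn; rewrite prefixE size_restr restr_take. Qed.

Lemma prefix_size (s t : seq bool) : prefix s t -> (size s <= size t)%N.
Proof. by move=> /prefixP[u ->]; rewrite size_cat leq_addr. Qed.

Lemma prefix_nth (s t : seq bool) i :
  prefix s t -> (i < size s)%N -> nth false t i = nth false s i.
Proof. by move=> /prefixP[u ->] Hi; rewrite nth_cat Hi. Qed.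

Lemma in_cond_restr p m n : in_cond (restr p.1 m, restr p.2 n) p.
Proof. by rewrite /in_cond /= !size_restr. Qed.

Lemma in_cond_ext c c' p : ext c c' -> in_cond c' p -> in_cond c p.
Proof.
move=> [e1 e2] [h1 h2]; split; apply/restrP => i Hi.
- rewrite -(prefix_nth e1 Hi); apply: (restrP _ _).1 => //.
  exact: leq_trans Hi (prefix_size e1).
- rewrite -(prefix_nth e2 Hi); apply: (restrP _ _).1 => //.
  exact: leq_trans Hi (prefix_size e2).
Qed.

Lemma in_cond_ext_restr c p m n : in_cond c p ->
  (size c.1 <= m)%N -> (size c.2 <= n)%N -> ext c (restr p.1 m, restr p.2 n).
Proof.
by move=> [h1 h2] m1 n2; split => /=; [rewrite -h1|rewrite -h2]; exact: prefix_restr.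
Qed.

Lemma in_cond_common c c' p : in_cond c p -> in_cond c' p ->
  exists e, [/\ ext c e, ext c' e & in_cond e p].
Proof.
move=> h h'; exists (restr p.1 (maxn (size c.1) (size c'.1)),
                     restr p.2 (maxn (size c.2) (size c'.2))).
by split; [apply: in_cond_ext_restr; rewrite ?leq_maxl
  |apply: in_cond_ext_restr; rewrite ?leq_maxr|exact: in_cond_restr].
Qed.

(* The Rasiowa-Sikorski lemma, that is, the Baire category theorem for the square of the Cantor space. *)
Lemma generic_exists (D : nat -> cond -> Prop) c :
  (forall k, dense_cond (D k)) ->
  exists p, in_cond c p /\ forall k, meets (D k) p.
Proof.
move=> dD.
(* Each move also pads both strings beyond length [k], so that the limit has all its coordinates
   decided. *)
have dD' k c' : exists c'', [/\ ext c' c'', D k c'', (k < size c''.1)%N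
    & (k < size c''.2)%N].
  have [c1 [e1 d1]] := dD k (c'.1 ++ nseq k.+1 false, c'.2 ++ nseq k.+1 false).
  exists c1; split => //.
  - by apply: ext_trans e1; split; exact: prefix_prefix.
  - by case: e1 => /prefix_size /= h _; apply: leq_trans h; rewrite size_cat /= size_nseq leq_addl.
  - by case: e1 => _ /prefix_size /= h; apply: leq_trans h; rewrite size_cat /= size_nseq leq_addl.
have [g Hg] := choice (fun kc : nat * cond => dD' kc.1 kc.2).
pose q := fix q n := if n is m.+1 then g (m, q m) else c.
have qS n : ext (q n) (q n.+1) by have [] := Hg (n, q n).
have qmono m n : (m <= n)%N -> ext (q m) (q n).
  elim: n => [|n IH]; first by rewrite leqn0 => /eqP ->; exact: ext_refl.
  rewrite leq_eqVlt => /orP[/eqP ->|/IH h]; first exact: ext_refl.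
  exact: ext_trans h (qS n).
pose p := ((fun i => nth false (q i.+1).1 i), (fun i => nth false (q i.+1).2 i)) : cantor * cantor.
have pq n : in_cond (q n) p.
  have sz i : (i < size (q i.+1).1)%N /\ (i < size (q i.+1).2)%N by have [] := Hg (i, q i).
  split; apply/restrP => i Hi /=; have [/qmono[e1 e2]|/ltnW/qmono[e1 e2]] := leqP n i.+1.
  - by rewrite (prefix_nth e1).
  - by rewrite -(prefix_nth e1)// (sz i).1.
  - by rewrite (prefix_nth e2).
  - by rewrite -(prefix_nth e2)// (sz i).2.
exists p; split; first exact: (pq 0).
by move=> k; exists (q k.+1); split => //; have [] := Hg (k, q k).
Qed.

Lemma meager_in_ext A c c' : ext c c' -> meager_in A c -> meager_in A c'.
Proof. by move=> e [D [dD H]]; exists D; split=> // p /(in_cond_ext e); exact: H. Qed.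

Lemma meager_in_sub (A B : cantor * cantor -> Prop) c :
  (forall p, A p -> B p) -> meager_in B c -> meager_in A c.
Proof. by move=> AB [D [dD H]]; exists D; split=> // p pc pD /AB; exact: H pc pD. Qed.

Lemma nmeager_in_ex A c : ~ meager_in A c -> exists p, in_cond c p /\ A p.
Proof.
move=> nM; apply: contrapT => nex; apply: nM; exists (fun _ _ => True); split.
  by move=> k c'; exists c'; split => //; exact: ext_refl.
by move=> p pc _ Ap; apply: nex; exists p.
Qed.

Definition countable_dense {I : countType} (D : I -> cond -> Prop) (n : nat) : cond -> Prop :=
  fun c => forall i, unpickle n = Some i -> D i c.

Lemma countable_dense_dense {I : countType} (D : I -> cond -> Prop) :
  (forall i, dense_cond (D i)) -> forall n, dense_cond (countable_dense D n).
Proof.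
move=> dD n c; rewrite /countable_dense; case: unpickle => [i|].
  by have [c' [e d]] := dD i c; exists c'; split => // j [<-].
by exists c; split => //; exact: ext_refl.
Qed.

Lemma countable_dense_meets {I : countType} (D : I -> cond -> Prop) p :
  (forall n, meets (countable_dense D n) p) -> forall i, meets (D i) p.
Proof.
move=> H i; have [c [pc dc]] := H (pickle i).
by exists c; split => //; apply: dc; rewrite pickleK.
Qed.

(** A generic point of [c] lies in some condition [e] where [A k] is meager, and then only has to
    meet the witnesses for [(k, e)]. The pairs [(k, e)] are countable in number, so all these
    witnesses together form a countable family. *)
Lemma meager_in_bigcup (A : nat -> cantor * cantor -> Prop) c :
  (forall k c', ext c c' -> exists c'', ext c' c'' /\ meager_in (A k) c'') ->
  meager_in (fun p => exists k, A k p) c.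
Proof.
move=> H.
have wit (ke : nat * cond) : exists D : nat -> cond -> Prop,
    (forall j, dense_cond (D j)) /\ (meager_in (A ke.1) ke.2 ->
    forall p, in_cond ke.2 p -> (forall j, meets (D j) p) -> ~ A ke.1 p).
  have [[D [dD HD]]|nM] := pselect (meager_in (A ke.1) ke.2); first by exists D.
  exists (fun _ _ => True); split => // _ c'.
  by exists c'; split => //; exact: ext_refl.
have [W HW] := choice wit.
(* The second disjunct admits the conditions incompatible with [c], which makes the family dense
   everywhere. *)
pose D (i : nat + nat * cond * nat) : cond -> Prop := match i with
  | inl k => fun e => meager_in (A k) e \/ ~ exists e', ext e e' /\ ext c e'
  | inr (ke, j) => W ke j
  end.
exists (countable_dense D); split.
  apply: countable_dense_dense => -[k|[ke j]] e; last exact: (HW ke).1.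
  have [[e' [ee' ce']]|nc] := pselect (exists e', ext e e' /\ ext c e').
    have [e'' [e1 e2]] := H k e' ce'.
    by exists e''; split; [exact: ext_trans e1|left].
  by exists e; split; [exact: ext_refl|right].
move=> p pc /countable_dense_meets pD [k Akp].
have [e [pe [Me|ne]]] := pD (inl k); last first.
  by apply: ne; have [e' [? ? _]] := in_cond_common pe pc; exists e'.
apply: ((HW (k, e)).2 Me p pe _ Akp) => j.
exact: (pD (inr ((k, e), j))).
Qed.

(** The Baire property of analytic sets, in the form needed here. A condition is
    in [B u] when [A u] is non-meager in every extension of it. A point meeting
    all the dense sets [W u] can be followed through the scheme along a branch of
    such conditions, and every non-meager set it passes contains a nearby point. *)
Lemma souslin_comeager (A : seq nat -> cantor * cantor -> Prop) :
  (forall u p, A u p -> exists k, A (rcons u k) p) ->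
  (forall n (f : nat -> nat) p,
     (forall j, exists q, [/\ A (n :: mkseq f j) q, restr q.1 j = restr p.1 j
                            & restr q.2 j = restr p.2 j]) -> A [:: n] p) ->
  ~ meager_in (A [::]) ([::], [::]) ->
  exists n c (D : nat -> cond -> Prop), (forall k, dense_cond (D k)) /\
    forall p, in_cond c p -> (forall k, meets (D k) p) -> A [:: n] p.
Proof.
move=> Asplit Alim nM.
pose B u c := forall c', ext c c' -> ~ meager_in (A u) c'.
have Bext u c c' : ext c c' -> B u c -> B u c'.
  by move=> cc' Bu c'' /(ext_trans cc'); exact: Bu.
(* Otherwise each [A (rcons u k)] would be meager in densely many conditions below [c], and so would
   their union, which covers [A u], be meager in [c]. *)
have Bsplit u c : B u c -> exists c', ext c c' /\ exists k, B (rcons u k) c'.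
  move=> Bu; apply: contrapT => nB; apply: (Bu c); first exact: ext_refl.
  apply: (@meager_in_sub _ (fun p => exists k, A (rcons u k) p)).
    by move=> p /Asplit.
  apply: meager_in_bigcup => k c' cc'; apply: contrapT => nM'; apply: nB.
  exists c'; split => //; exists k => c'' cc'' M''.
  by apply: nM'; exists c''.
pose W u c := meager_in (A u) c \/ exists k, B (rcons u k) c.
have dW u : dense_cond (W u).
  move=> c; have [Bu|nB] := pselect (B u c).
    by have [c' [e kB]] := Bsplit u c Bu; exists c'; split => //; right.
  move/existsNP: nB => [c' /not_implyP[cc' /contrapT M']].
  by exists c'; split => //; left.
have [c1 B1] : exists c1, B [::] c1.
  apply: contrapT => nB; apply: nM.
  (* A constant family turns [meager_in_bigcup] into the principle that a locally meager set is
     meager. *)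
  apply: (@meager_in_sub _ (fun p => exists k : nat, A [::] p)).
    by move=> p; exists 0%N.
  apply: meager_in_bigcup => _ c' _.
  have /existsNP[c'' /not_implyP[cc'' /contrapT M'']] : ~ B [::] c'.
    by move=> h; apply: nB; exists c'.
  by exists c''.
have [c0 [_ [n /= B0]]] := Bsplit _ _ B1.
exists n, c0, (countable_dense W); split; first exact: countable_dense_dense.
move=> p pc0 /countable_dense_meets pW.
have step u : (exists c, in_cond c p /\ B u c) ->
    exists k, exists c, in_cond c p /\ B (rcons u k) c.
  move=> [c [pc Bc]]; have [e [pe [Me|[k Be]]]] := pW u; last by exists k, e.
  have [e' [ce' ee' _]] := in_cond_common pc pe.
  by case: (Bc e' ce'); exact: meager_in_ext Me.
pose good u := `[< exists c, in_cond c p /\ B u c >].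
have step' u : exists k, good u -> good (rcons u k).
  have [g|g] := pselect (good u); last by exists 0%N.
  by move/asboolP : (g) => /step[k h]; exists k => _; apply/asboolP.
have [nx Hnx] := choice step'.
pose s := fix s j := if j is i.+1 then rcons (s i) (nx (s i)) else [:: n].
pose f j := nx (s j).
have sf j : s j = n :: mkseq f j.
  by elim: j => //= j IH; rewrite mkseqS -rcons_cons -IH.
have gs j : good (s j).
  elim: j => [|j IH /=]; last exact: Hnx.
  by apply/asboolP; exists c0.
apply: (Alim n f) => j.
have /asboolP[c [pc Bc]] := gs j.
(* With both strings at least [j] long, every point of the condition agrees with [p] on the first
   [j] coordinates. *)
have cc' := in_cond_ext_restr pc (leq_maxl _ j) (leq_maxl _ j).
have [q [qc Aq]] := nmeager_in_ex (Bc _ cc').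
have [q1 q2] := qc; move: q1 q2; rewrite /= !size_restr => q1 q2.
exists q; split; first by rewrite -sf.
- by rewrite -(restr_take _ (leq_maxr (size c.1) j)) q1 restr_take ?leq_maxr.
- by rewrite -(restr_take _ (leq_maxr (size c.2) j)) q2 restr_take ?leq_maxr.
Qed.

Definition flip_at (m : nat) (a : cantor) : cantor :=
  fun i => if i == m then ~~ a i else a i.

(** Flipping a coordinate beyond the first string of [c] is a homeomorphism of this basic set onto
    itself, so a sufficiently generic point has a generic flip. *)
Lemma comeager_flip (A : cantor * cantor -> Prop) c (D : nat -> cond -> Prop) :
  (forall k, dense_cond (D k)) ->
  (forall p, in_cond c p -> (forall k, meets (D k) p) -> A p) ->
  forall m, (size c.1 <= m)%N ->
  exists a b, A (a, b) /\ A (flip_at m a, b).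
Proof.
move=> dD HA m cm.
pose fl (s : seq bool) := set_nth false s m (~~ nth false s m).
(* The second half pulls [D k] back along the flip; it asks for strings longer than [m], since
   [set_nth] would lengthen shorter ones. *)
pose D' (k : nat + nat) : cond -> Prop := match k with
  | inl k => D k
  | inr k => fun c => (m < size c.1)%N /\ D k (fl c.1, c.2) end.
have szfl s : (m < size s)%N -> size (fl s) = size s.
  by move=> ms; rewrite /fl size_set_nth (maxn_idPr ms).
have nthfl s i : nth false (fl s) i = if i == m then ~~ nth false s i else nth false s i.
  by rewrite /fl nth_set_nth /=; case: eqP => // ->.
have [|[a b] [pc pD]] := @generic_exists (countable_dense D') c.
  apply: countable_dense_dense => -[k|k] //= e.
  pose e1 := e.1 ++ nseq m.+1 false.
  have me1 : (m < size e1)%N by rewrite size_cat /= size_nseq leq_addl.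
  have [e2 [[h1 h2] De2]] := dD k (fl e1, e.2).
  have me2 : (m < size e2.1)%N.
    by apply: leq_trans (prefix_size h1) => /=; rewrite szfl.
  exists (fl e2.1, e2.2); split; last first.
    rewrite /= szfl//; split => //.
    rewrite (_ : fl (fl _) = e2.1) -?surjective_pairing//.
    apply: (@eq_from_nth _ false); first by rewrite !szfl// szfl.
    by move=> i _; rewrite !nthfl; case: eqP => // _; rewrite negbK.
  split => //=; apply: (prefix_trans (prefix_prefix _ (nseq m.+1 false))).
  rewrite -/e1 prefixE; apply/eqP/(@eq_from_nth _ false).
    rewrite size_take szfl//; have := prefix_size h1; rewrite /= szfl// => h.
    by move: h; rewrite leq_eqVlt => /orP[/eqP ->|->//]; rewrite ltnn.
  move=> i; rewrite size_take => Hi.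
  have Hi1 : (i < size e1)%N.
    by move: Hi; case: ifP => // /negbT; rewrite -leqNgt => h /leq_trans; apply.
  rewrite nth_take// nthfl (prefix_nth h1) ?szfl// nthfl.
  by case: eqP => // _; rewrite negbK.
have {}pD := countable_dense_meets pD.
exists a, b; split; first by apply: HA => // k; exact: (pD (inl k)).
apply: HA => [|k].
  case: pc => /= /restrP pc1 pc2; split => //=; apply/restrP => i Hi.
  by rewrite /flip_at ifN ?pc1// neq_ltn (leq_trans Hi cm).
have [e [[/= /restrP e1 e2] [me De]]] := pD (inr k).
exists (fl e.1, e.2); split => //; split => //=; apply/restrP => i.
by rewrite szfl// => Hi; rewrite nthfl /flip_at e1.
Qed.

(* Mycielski's tree construction, restricted to pairs of distinct branches *)
Lemma meager_perfect (A : cantor * cantor -> Prop) :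
  meager_in A ([::], [::]) ->
  exists phi : cantor -> cantor, forall a b, a <> b -> ~ A (phi a, phi b).
Proof.
move=> [D [dD HD]].
(* One level of the tree: finitely many requirements on pairs of distinct nodes are met one after
   another, and later extensions preserve earlier successes. *)
have grow (g : seq bool -> seq bool) (ts : seq (seq bool * seq bool * nat)) :
    exists g' : seq bool -> seq bool, (forall s, prefix (g s) (g' s)) /\
      forall t, t \in ts -> t.1.1 <> t.1.2 ->
        exists e, D t.2 e /\ ext e (g' t.1.1, g' t.1.2).
  elim: ts => [|[[s t] j] ts [g1 [gg1 H1]]].
    by exists g; split => // s; exact: prefix_refl.
  have [st|st] := eqVneq s t.
    exists g1; split => // u; rewrite inE => /orP[/eqP -> /=|]; last exact: H1.
    by rewrite st.
  have [[c1 c2] [[/= e1 e2] Dc]] := dD j (g1 s, g1 t).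
  pose g2 r := if r == s then c1 else if r == t then c2 else g1 r.
  have g12 r : prefix (g1 r) (g2 r).
    rewrite /g2; case: eqP => [->//|_]; case: eqP => [->//|_]; exact: prefix_refl.
  exists g2; split => [r|u].
    exact: prefix_trans (gg1 r) (g12 r).
  rewrite inE => /orP[/eqP -> /= _|uts ne].
    exists (c1, c2); split => //; rewrite /g2 eqxx eq_sym (negPf st) eqxx.
    exact: ext_refl.
  have [e [De ee]] := H1 u uts ne; exists e; split => //.
  by apply: ext_trans ee _; split; exact: g12.
have [N HN] := choice (fun gt => grow gt.1 gt.2).
(* Level [k] treats all pairs of nodes against the first [k] dense families, so a fixed family is
   met at every later level. *)
pose tk k : seq (seq bool * seq bool * nat) :=
  let l := map (@tval k bool) (enum {: k.-tuple bool}) in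
  [seq (st, j) | st <- [seq (s, t) | s <- l, t <- l], j <- iota 0 k].
pose G := fix G k := if k is j.+1
  then N ((fun s => rcons (G j (take j s)) false), tk j.+1) else fun _ => [::].
have GS k s : prefix (rcons (G k (take k s)) false) (G k.+1 s).
  exact: (HN ((fun s => rcons (G k (take k s)) false), tk k.+1)).1.
pose M a k := G k (restr a k).
have MS a k : prefix (rcons (M a k) false) (M a k.+1).
  by have := GS k (restr a k.+1); rewrite restr_take.
have Mmono a m n : (m <= n)%N -> prefix (M a m) (M a n).
  elim: n => [|n IH]; first by rewrite leqn0 => /eqP ->; exact: prefix_refl.
  rewrite leq_eqVlt => /orP[/eqP ->|/IH h]; first exact: prefix_refl.
  apply: prefix_trans h (prefix_trans _ (MS a n)); exact: prefix_rcons.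
have Msz a k : (k <= size (M a k))%N.
  elim: k => // k IH; apply: leq_trans (prefix_size (MS a k)).
  by rewrite size_rcons.
pose phi (a : cantor) : cantor := fun i => nth false (M a i.+1) i.
exists phi => a b ab.
have Mphi c k : restr (phi c) (size (M c k)) = M c k.
  apply/restrP => i Hi; rewrite /phi.
  have [/(Mmono c) h|/ltnW/(Mmono c) h] := leqP k i.+1.
    by rewrite (prefix_nth h).
  by rewrite -(prefix_nth h)// (Msz c i.+1).
apply: (HD (phi a, phi b)) => [|k]; first by split.
have [m nm] : exists m, a m <> b m.
  by apply/existsNP => h; apply: ab; apply/funext.
(* At this level the two branches have separated and [D k] is on the list. *)
pose n := (maxn k m).+1.
have [||e [De ee]] := (HN ((fun s => rcons (G n.-1 (take n.-1 s)) false), tk n)).2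
    (restr a n, restr b n, k).
- have tn c : restr c n \in map (@tval n bool) (enum {: n.-tuple bool}).
    apply/mapP; exists (Tuple (introT eqP (size_restr c n))) => //.
    by rewrite mem_enum.
  apply/allpairsP; exists ((restr a n, restr b n), k); split => //.
    by apply/allpairsP; exists (restr a n, restr b n); split; [exact: tn|exact: tn|].
  by rewrite mem_iota add0n ltnS leq_maxl.
- move=> /= h; apply: nm.
  have mn : (m < n)%N by rewrite ltnS leq_maxr.
  by rewrite -(nth_restr a mn) h nth_restr.
exists e; split => //; apply: (in_cond_ext ee).
by split => /=; [exact: (Mphi a n)|exact: (Mphi b n)].
Qed.

(** * Paths and homotopies *)

Section CtsOn.
Context {R : realType}.
Implicit Types (S T U : topologicalType).

(** Continuity on a subset in terms of filters, which composes and pastes without passing through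
    the subspace type. *)
Definition cts_on T U (D : set T) (f : T -> U) : Prop :=
  forall x, D x -> f y @[y --> within D (nbhs x)] --> f x.

Lemma cts_onP T U (D : set T) (f : T -> U) : {within D, continuous f} <-> cts_on D f.
Proof. exact: subspace_continuousP. Qed.

Lemma cts_on_comp S T U (C : set S) (D : set T) (f : T -> U) (g : S -> T) :
  cts_on D f -> cts_on C g -> (forall x, C x -> D (g x)) -> cts_on C (fun x => f (g x)).
Proof.
move=> fD gC CD x Cx A /(fD _ (CD x Cx)) fA.
have := gC x Cx _ fA; rewrite !nbhs_simpl /within /=; apply: filterS => y h Cy.
exact: h Cy (CD y Cy).
Qed.

Lemma cts_on_eq T U (D : set T) (f g : T -> U) :
  (forall x, D x -> f x = g x) -> cts_on D f -> cts_on D g.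
Proof.
move=> fg fD x Dx A; rewrite -fg// => /(fD _ Dx) h.
move: h; rewrite !nbhs_simpl /within /=; apply: filterS => y h Dy.
by rewrite -fg//; exact: h.
Qed.

Lemma cts_on_continuous T U (D : set T) (f : T -> U) : continuous f -> cts_on D f.
Proof. by move=> fc x _; apply: cvg_within_filter; exact: fc. Qed.

Lemma cts_on_cst T U (D : set T) (c : U) : cts_on D (fun _ : T => c).
Proof. by apply: cts_on_continuous => x; exact: cvg_cst. Qed.

Lemma cts_on_id T (D : set T) : cts_on D (fun x : T => x).
Proof. by apply: cts_on_continuous => x. Qed.

Lemma cts_on_fst S T (D : set (S * T)) : cts_on D (fun p : S * T => p.1).
Proof. by apply: cts_on_continuous => x; exact: cvg_fst. Qed.

Lemma cts_on_snd S T (D : set (S * T)) : cts_on D (fun p : S * T => p.2).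
Proof. by apply: cts_on_continuous => x; exact: cvg_snd. Qed.

Lemma cts_on_pair S T U (D : set S) (f : S -> T) (g : S -> U) :
  cts_on D f -> cts_on D g -> cts_on D (fun x => (f x, g x)).
Proof. by move=> fD gD x Dx; apply: cvg_pair; [exact: fD|exact: gD]. Qed.

Lemma cts_onD T (D : set T) (f g : T -> R) :
  cts_on D f -> cts_on D g -> cts_on D (fun x => f x + g x).
Proof. by move=> fD gD x Dx; apply: cvgD; [exact: fD|exact: gD]. Qed.

Lemma cts_onN T (D : set T) (f : T -> R) : cts_on D f -> cts_on D (fun x => - f x).
Proof. by move=> fD x Dx; exact: (cvgN (fD x Dx)). Qed.

Lemma cts_onM T (D : set T) (f g : T -> R) :
  cts_on D f -> cts_on D g -> cts_on D (fun x => f x * g x).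
Proof. by move=> fD gD x Dx; apply: cvgM; [exact: fD|exact: gD]. Qed.

Lemma cts_on_paste T U (D : set T) (h : T -> R) (c : R) (f g : T -> U) :
  continuous h ->
  cts_on (D `&` [set x | h x <= c]) f -> cts_on (D `&` [set x | c <= h x]) g ->
  (forall x, D x -> h x = c -> f x = g x) ->
  cts_on D (fun x => if h x <= c then f x else g x).
Proof.
move=> hc fD gD fg x Dx A FA.
have lt_near y : h y < c -> \forall z \near y, h z < c.
  move=> yc; have /hc : nbhs (h y) [set z | z < c] by
    apply: open_nbhs_nbhs; split => //; exact: open_lt.
  by [].
have gt_near y : c < h y -> \forall z \near y, c < h z.
  move=> yc; have /hc : nbhs (h y) [set z | c < z] by
    apply: open_nbhs_nbhs; split => //; exact: open_gt.
  by [].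
have n1 : \forall y \near x, D y -> h y <= c -> A (f y).
  have [xc|xc] := leP (h x) c; last first.
    by move: (gt_near _ xc); apply: filterS => y cy _; rewrite leNgt cy.
  move: FA; rewrite xc => /(fD _ (conj Dx xc)).
  by rewrite !nbhs_simpl /within /=; apply: filterS => y H Dy hy; exact: H.
have n2 : \forall y \near x, D y -> c < h y -> A (g y).
  have [xc|xc] := ltP (h x) c.
    by move: (lt_near _ xc); apply: filterS => y cy _; rewrite ltNge (ltW cy).
  have : nbhs (g x) A.
    move: FA; case: ifP => // hx; rewrite fg//.
    by apply/eqP; rewrite eq_le hx xc.
  move=> /(gD _ (conj Dx xc)); rewrite !nbhs_simpl /within /=.
  by apply: filterS => y H Dy /ltW hy; exact: H.
rewrite nbhs_simpl /within /=; move: n1 n2; apply: filterS2 => y H1 H2 Dy.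
by change (A (if h y <= c then f y else g y)); case: lerP => hy; [exact: H1|exact: H2].
Qed.

End CtsOn.

Ltac cts := lazymatch goal with
  | |- cts_on _ (fun _ => ?c) => exact: cts_on_cst
  | |- cts_on _ (fun x => x) => exact: cts_on_id
  | |- cts_on _ (fun x => x.1) => exact: cts_on_fst
  | |- cts_on _ (fun x => x.2) => exact: cts_on_snd
  | |- cts_on _ fst => exact: cts_on_fst
  | |- cts_on _ snd => exact: cts_on_snd
  | |- cts_on _ (GRing.mul ?c) => apply: (@cts_onM _ _ _ (fun _ => c) id); cts
  | |- cts_on _ (GRing.add ?c) => apply: (@cts_onD _ _ _ (fun _ => c) id); cts
  | |- cts_on _ id => exact: cts_on_id
  | |- cts_on _ (fun x => (@?f x, @?g x)) => apply: (@cts_on_pair _ _ _ _ f g); cts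
  | |- cts_on _ (fun x => @?f x + @?g x) => apply: (@cts_onD _ _ _ f g); cts
  | |- cts_on _ (fun x => - @?f x) => apply: (@cts_onN _ _ _ f); cts
  | |- cts_on _ (fun x => @?f x * @?g x) => apply: (@cts_onM _ _ _ f g); cts
  | |- _ => idtac
  end.

Section Homotopy.
Context {R : realType} {X : topologicalType}.
Implicit Types (f g h : R -> X).

Lemma unit0 : unit_I (0 : R). Proof. by rewrite /unit_I /=; lra. Qed.
Lemma unit1 : unit_I (1 : R). Proof. by rewrite /unit_I /=; lra. Qed.

Lemma unit_I_convex (a b t : R) : unit_I a -> unit_I b -> unit_I t ->
  unit_I ((1 - t) * a + t * b).
Proof.
rewrite /unit_I /= => /andP[a0 a1] /andP[b0 b1] /andP[t0 t1].
have t1' : 0 <= 1 - t by lra.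
have a1' : 0 <= 1 - a by lra.
have b1' : 0 <= 1 - b by lra.
have := mulr_ge0 t1' a0; have := mulr_ge0 t0 b0.
by have := mulr_ge0 t1' a1'; have := mulr_ge0 t0 b1'; lra.
Qed.

Lemma continuous_fst_R : continuous (fun p : R * R => p.1).
Proof. by move=> x; exact: cvg_fst. Qed.
Lemma continuous_snd_R : continuous (fun p : R * R => p.2).
Proof. by move=> x; exact: cvg_snd. Qed.

(** The straight-line homotopy in the convex domain, pushed forward by [sg]. Reparametrizations and
    singular triangles are both instances. *)
Lemma homotopic_convex (D : set (R * R)) (sg : R * R -> X) (p q : R -> R * R) :
  (forall a b t, D a -> D b -> unit_I t ->
    D ((1 - t) * a.1 + t * b.1, (1 - t) * a.2 + t * b.2)) ->
  cts_on D sg -> cts_on unit_I p -> cts_on unit_I q ->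
  (forall s, unit_I s -> D (p s)) -> (forall s, unit_I s -> D (q s)) ->
  p 0 = q 0 -> p 1 = q 1 ->
  path_homotopic (fun s => sg (p s)) (fun s => sg (q s)).
Proof.
move=> cD cs cp cq Dp Dq pq0 pq1.
exists (fun x => sg ((1 - x.2) * (p x.1).1 + x.2 * (q x.1).1,
                 (1 - x.2) * (p x.1).2 + x.2 * (q x.1).2)); split.
- apply/cts_onP; apply: (cts_on_comp cs); last first.
    by move=> [s t] [/= s1 t1]; apply: cD => //; [exact: Dp|exact: Dq].
  have cp' : cts_on unit_sq (fun x : R * R => p x.1).
    by apply: (cts_on_comp cp); [cts|move=> x []].
  have cq' : cts_on unit_sq (fun x : R * R => q x.1).
    by apply: (cts_on_comp cq); [cts|move=> x []].
  have fst' (u : R * R -> R * R) : cts_on unit_sq u -> cts_on unit_sq (fun x => (u x).1).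
    by move=> cu; apply: (@cts_on_comp _ _ _ _ setT fst) => //; cts.
  have snd' (u : R * R -> R * R) : cts_on unit_sq u -> cts_on unit_sq (fun x => (u x).2).
    by move=> cu; apply: (@cts_on_comp _ _ _ _ setT snd) => //; cts.
  by cts; [exact: fst'|exact: fst'|exact: snd'|exact: snd'].
- move=> s _ /=; rewrite subr0 subrr !mul1r !mul0r !addr0 !add0r.
  by rewrite -!surjective_pairing.
- move=> t _ /=; rewrite -pq0 -pq1 -!mulrDl !subrK !mul1r.
  by rewrite -!surjective_pairing.
Qed.

Lemma homotopic_reparam f (p q : R -> R) :
  cts_on unit_I f -> cts_on unit_I p -> cts_on unit_I q ->
  (forall s, unit_I s -> unit_I (p s)) -> (forall s, unit_I s -> unit_I (q s)) ->
  p 0 = q 0 -> p 1 = q 1 ->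
  path_homotopic (fun s => f (p s)) (fun s => f (q s)).
Proof.
move=> cf cp cq Ip Iq pq0 pq1.
apply: (@homotopic_convex [set x | unit_I x.1] (fun x => f x.1)
  (fun s => (p s, 0)) (fun s => (q s, 0))) => //=; rewrite ?pq0 ?pq1 //.
- by move=> a b t a1 b1 t1; exact: unit_I_convex.
- by apply: (cts_on_comp cf); [cts|].
- by cts.
- by cts.
Qed.

Lemma homotopic_eq f g : cts_on unit_I f -> (forall s, unit_I s -> f s = g s) ->
  path_homotopic f g.
Proof.
move=> cf fg; exists (fun x => f x.1); split=> //.
- by apply/cts_onP; apply: (cts_on_comp cf); [cts|move=> x []].
- by move=> s Is; rewrite -fg.
Qed.

Lemma homotopic_ends f g : path_homotopic f g -> f 0 = g 0 /\ f 1 = g 1.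
Proof.
move=> [H [_ H1 H2]]; have [h1 h2] := H2 _ unit1.
by rewrite -h1 -h2 -(H1 _ unit0).2 -(H1 _ unit1).2.
Qed.

Lemma homotopic_sym f g : path_homotopic f g -> path_homotopic g f.
Proof.
move=> fg; have [fg0 fg1] := homotopic_ends fg; move: fg => [H [cH H1 H2]].
exists (fun x => H (x.1, 1 - x.2)); split.
- apply/cts_onP; apply: (cts_on_comp ((cts_onP _ _).1 cH)); first by cts.
  by move=> x [x1 x2]; split => //=; move: x2; rewrite /unit_I /=; lra.
- by move=> s Is /=; rewrite subr0 subrr; have [] := H1 s Is.
- move=> t It /=; rewrite -fg0 -fg1; apply: H2.
  by move: It; rewrite /unit_I /=; lra.
Qed.

Lemma homotopic_trans g f h : path_homotopic f g -> path_homotopic g h ->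
  path_homotopic f h.
Proof.
move=> fg; have [fg0 fg1] := homotopic_ends fg; move: fg => [H [cH H1 H2]].
move=> [K [cK K1 K2]].
exists (fun x => if x.2 <= 2^-1 then H (x.1, 2 * x.2) else K (x.1, 2 * x.2 - 1)); split.
- apply/cts_onP; apply: cts_on_paste; first exact: continuous_snd_R.
  + apply: (cts_on_comp ((cts_onP _ _).1 cH)); first by cts.
    by move=> x [[x1 x2] /= x3]; split => //=; move: x2; rewrite /unit_I /=; lra.
  + apply: (cts_on_comp ((cts_onP _ _).1 cK)); first by cts.
    by move=> x [[x1 x2] /= x3]; split => //=; move: x2; rewrite /unit_I /=; lra.
  + move=> x [x1 _] ->; rewrite divff ?pnatr_eq0// subrr.
    by rewrite (H1 _ x1).2 (K1 _ x1).1.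
- move=> s Is /=; rewrite ifT; last lra.
  rewrite ifF; last by apply/negbTE; rewrite -ltNge; lra.
  rewrite mulr0 mulr1 (_ : 2 - 1 = 1 :> R); last lra.
  by rewrite (H1 _ Is).1 (K1 _ Is).2.
- move=> t; rewrite /unit_I /= => It; case: lerP => ht.
    by apply: H2; rewrite /unit_I /=; lra.
  by rewrite fg0 fg1; apply: K2; rewrite /unit_I /=; lra.
Qed.

Lemma concat_cts f g : cts_on unit_I f -> cts_on unit_I g -> f 1 = g 0 ->
  cts_on unit_I (path_concat f g).
Proof.
move=> cf cg fg; apply: cts_on_paste; first by move=> x.
- apply: (cts_on_comp cf); first by cts.
  by move=> x []; rewrite /unit_I /=; lra.
- apply: (cts_on_comp cg); first by cts.
  by move=> x []; rewrite /unit_I /=; lra.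
- by move=> x _ ->; rewrite divff ?pnatr_eq0// subrr.
Qed.

Lemma concat0 f g : path_concat f g 0 = f 0.
Proof. by rewrite /path_concat ifT ?mulr0//; lra. Qed.

Lemma concat1 f g : path_concat f g 1 = g 1.
Proof.
rewrite /path_concat ifF; last by apply/negbTE; rewrite -ltNge; lra.
by congr g; lra.
Qed.

Lemma rev_cts f : cts_on unit_I f -> cts_on unit_I (path_rev f).
Proof.
move=> cf; apply: (cts_on_comp cf); first by cts.
by move=> x; rewrite /unit_I /=; lra.
Qed.

Lemma homotopic_concat f1 f2 g1 g2 :
  path_homotopic f1 f2 -> path_homotopic g1 g2 -> f1 1 = g1 0 ->
  path_homotopic (path_concat f1 g1) (path_concat f2 g2).
Proof.
move=> [H [cH H1 H2]] [K [cK K1 K2]] fg.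
exists (fun x => if x.1 <= 2^-1 then H (2 * x.1, x.2) else K (2 * x.1 - 1, x.2)); split.
- apply/cts_onP; apply: cts_on_paste; first exact: continuous_fst_R.
  + apply: (cts_on_comp ((cts_onP _ _).1 cH)); first by cts.
    by move=> x [[x1 x2] /= x3]; split => //=; move: x1; rewrite /unit_I /=; lra.
  + apply: (cts_on_comp ((cts_onP _ _).1 cK)); first by cts.
    by move=> x [[x1 x2] /= x3]; split => //=; move: x1; rewrite /unit_I /=; lra.
  + move=> x [_ x2] ->; rewrite divff ?pnatr_eq0// subrr.
    by rewrite (H2 _ x2).2 (K2 _ x2).1.
- move=> s; rewrite /path_concat /unit_I /= => Is; case: lerP => hs.
    by apply: H1; rewrite /unit_I /=; lra.
  by apply: K1; rewrite /unit_I /=; lra.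
- move=> t It /=; rewrite concat0 concat1 ifT; last lra.
  rewrite ifF; last by apply/negbTE; rewrite -ltNge; lra.
  rewrite mulr0 mulr1 (_ : 2 - 1 = 1 :> R); last lra.
  by rewrite (H2 _ It).1 (K2 _ It).2.
Qed.

Lemma homotopic_rev f g : path_homotopic f g -> path_homotopic (path_rev f) (path_rev g).
Proof.
move=> [H [cH H1 H2]]; exists (fun x => H (1 - x.1, x.2)); split.
- apply/cts_onP; apply: (cts_on_comp ((cts_onP _ _).1 cH)); first by cts.
  by move=> x [x1 x2]; split => //=; move: x1; rewrite /unit_I /=; lra.
- by move=> s Is; apply: H1; move: Is; rewrite /unit_I /=; lra.
- by move=> t It; rewrite /path_rev subrr subr0; have [] := H2 t It.
Qed.

Lemma homotopic_assoc f g h :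
  cts_on unit_I f -> cts_on unit_I g -> cts_on unit_I h -> f 1 = g 0 -> g 1 = h 0 ->
  path_homotopic (path_concat (path_concat f g) h) (path_concat f (path_concat g h)).
Proof.
move=> cf cg ch fg gh.
(* The piecewise linear map taking the breakpoints 1/4, 1/2 of the left bracketing to the
   breakpoints 1/2, 3/4 of the right one. *)
pose p (s : R) := if s <= 2^-1 then (if s <= 4^-1 then 2 * s else s + 4^-1)
                  else s / 2 + 2^-1.
have cF : cts_on unit_I (path_concat f (path_concat g h)).
  by apply: concat_cts; [|exact: concat_cts|rewrite concat0].
apply: (@homotopic_trans (fun s => path_concat f (path_concat g h) (p s))).
  apply: homotopic_eq.
    by do 2?apply: concat_cts; rewrite ?concat1.
  move=> s; rewrite /unit_I /p /path_concat /= => Is.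
  have [s2|s2] := leP s 2^-1.
    have [s4|s4] := leP s 4^-1.
      by rewrite !ifT//; lra.
    rewrite ifF; last by apply/negbTE; rewrite -ltNge; lra.
    rewrite ifF; last by apply/negbTE; rewrite -ltNge; lra.
    by rewrite ifT; [congr g; lra|lra].
  rewrite ifF; last by apply/negbTE; rewrite -ltNge; lra.
  rewrite ifF; last by apply/negbTE; rewrite -ltNge; lra.
  by congr h; lra.
apply: (@homotopic_reparam _ p (fun s => s)) => //; last 2 first.
- by rewrite /p !ifT; lra.
- rewrite /p ifF; last by apply/negbTE; rewrite -ltNge; lra.
  by lra.
- apply: cts_on_paste; [by move=> x| |by cts|].
    apply: cts_on_paste; [by move=> x|by cts|by cts|].
    by move=> x _ ->; lra.
  move=> x _ ->; rewrite ifF; last by apply/negbTE; rewrite -ltNge; lra.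
  by lra.
- by cts.
- by move=> s; rewrite /unit_I /p /=; case: (lerP s 2^-1) => ?; [case: (lerP s 4^-1) => ?|]; lra.
Qed.

Lemma homotopic_const_l f : cts_on unit_I f ->
  path_homotopic (path_concat (const_path (f 0)) f) f.
Proof.
move=> cf; pose p (s : R) := if s <= 2^-1 then 0 else 2 * s - 1.
apply: (@homotopic_trans (fun s => f (p s))).
  apply: homotopic_eq; first by apply: concat_cts => //; exact: cts_on_cst.
  by move=> s _; rewrite /path_concat /p /const_path; case: lerP.
apply: (@homotopic_reparam _ p (fun s => s)) => //; last 2 first.
- by rewrite /p ifT; lra.
- by rewrite /p ifF; [lra|apply/negbTE; rewrite -ltNge; lra].
- apply: cts_on_paste; [by move=> x|by cts|by cts|].
  by move=> x _ ->; lra.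
- by cts.
- by move=> s; rewrite /unit_I /p /=; case: (lerP s 2^-1) => ?; lra.
Qed.

Lemma homotopic_const_r f : cts_on unit_I f ->
  path_homotopic (path_concat f (const_path (f 1))) f.
Proof.
move=> cf; pose p (s : R) := if s <= 2^-1 then 2 * s else 1.
apply: (@homotopic_trans (fun s => f (p s))).
  apply: homotopic_eq; first by apply: concat_cts => //; exact: cts_on_cst.
  by move=> s _; rewrite /path_concat /p /const_path; case: lerP.
apply: (@homotopic_reparam _ p (fun s => s)) => //; last 2 first.
- by rewrite /p ifT; lra.
- by rewrite /p ifF; [lra|apply/negbTE; rewrite -ltNge; lra].
- apply: cts_on_paste; [by move=> x|by cts|by cts|].
  by move=> x _ ->; lra.
- by cts.
- by move=> s; rewrite /unit_I /p /=; case: (lerP s 2^-1) => ?; lra.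
Qed.

Lemma homotopic_rev_r f : cts_on unit_I f ->
  path_homotopic (path_concat f (path_rev f)) (const_path (f 0)).
Proof.
(* Running out and back is [f] composed with a tent map, which contracts linearly to 0. *)
move=> cf; pose p (s : R) := if s <= 2^-1 then 2 * s else 2 - 2 * s.
apply: (@homotopic_trans (fun s => f (p s))).
  apply: homotopic_eq.
    by apply: concat_cts; [|exact: rev_cts|rewrite /path_rev subr0].
  move=> s _; rewrite /path_concat /p /path_rev; case: lerP => // _.
  by congr f; lra.
apply: (@homotopic_reparam _ p (fun s => 0)) => //; last 2 first.
- by rewrite /p ifT; lra.
- by rewrite /p ifF; [lra|apply/negbTE; rewrite -ltNge; lra].
- apply: cts_on_paste; [by move=> x|by cts|by cts|].
  by move=> x _ ->; lra.
- by cts.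
- by move=> s; rewrite /unit_I /p /=; case: (lerP s 2^-1) => ?; lra.
- by move=> s; rewrite /unit_I /=; lra.
Qed.

(** The path through the middle vertex and the direct edge are homotopic inside the convex triangle;
    this is the relation that lets [edge_cls] kill boundaries. *)
Lemma homotopic_simplex2 (sg : R * R -> X) : cts_on simplex2 sg ->
  path_homotopic (path_concat (face2 sg) (face0 sg)) (face1 sg).
Proof.
move=> cs.
pose p (s : R) : R * R := if s <= 2^-1 then (2 * s, 0) else (2 - 2 * s, 2 * s - 1).
apply: (@homotopic_trans (fun s => sg (p s))).
  apply: homotopic_eq.
    apply: concat_cts.
    - apply: (cts_on_comp cs); first by cts.
      by move=> s; rewrite /unit_I /simplex2 /=; lra.
    - apply: (cts_on_comp cs); first by cts.
      by move=> s; rewrite /unit_I /simplex2 /=; lra.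
    - by rewrite /face2 /face0 subr0.
  move=> s _; rewrite /path_concat /face2 /face0 /p; case: lerP => // _.
  by congr (sg (_, _)); lra.
apply: (@homotopic_convex simplex2 sg p (fun s => (0, s))) => //; last 2 first.
- by rewrite /p ifT; [congr pair; lra|lra].
- rewrite /p ifF; [congr pair; lra|apply/negbTE; rewrite -ltNge; lra].
- move=> [a1 a2] [b1 b2] t; rewrite /unit_I /simplex2 /= => -[a10 [a20 a]] [b10 [b20 b]] /andP[t0 t1].
  have t1' : 0 <= 1 - t by lra.
  have a' : 0 <= 1 - (a1 + a2) by lra.
  have b' : 0 <= 1 - (b1 + b2) by lra.
  have := mulr_ge0 t1' a'; have := mulr_ge0 t0 b'.
  have := mulr_ge0 t1' a10; have := mulr_ge0 t0 b10.
  by have := mulr_ge0 t1' a20; have := mulr_ge0 t0 b20; lra.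
- apply: cts_on_paste; [by move=> x|by cts|by cts|].
  by move=> x _ ->; congr pair; lra.
- by cts.
- by move=> s; rewrite /unit_I /simplex2 /p /=; case: (lerP s 2^-1) => /= ?; lra.
- by move=> s; rewrite /unit_I /simplex2 /=; lra.
Qed.

End Homotopy.

(** * The fundamental groupoid and commutator length *)

Section Groupoid.
Context {R : realType} {X : topologicalType}.
Implicit Types (x y z w : X).

(** With endpoints in the type, products of classes are always defined and satisfy the groupoid
    laws; paths joining different base points are treated like loops. *)
Record path_from_to x y := Path {
  path_fun :> R -> X;
  path_funP : cts_on unit_I path_fun /\ path_fun 0 = x /\ path_fun 1 = y }.

HB.instance Definition _ x y := gen_eqMixin (path_from_to x y).
HB.instance Definition _ x y := gen_choiceMixin (path_from_to x y).

Lemma path_cts x y (p : path_from_to x y) : cts_on unit_I p.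
Proof. exact: (path_funP p).1. Qed.
Lemma path0 x y (p : path_from_to x y) : p 0 = x.
Proof. exact: (path_funP p).2.1. Qed.
Lemma path1 x y (p : path_from_to x y) : p 1 = y.
Proof. exact: (path_funP p).2.2. Qed.

Lemma pid_subproof x : cts_on unit_I (@const_path R X x) /\
  @const_path R X x 0 = x /\ @const_path R X x 1 = x.
Proof. by split; [exact: cts_on_cst|]. Qed.
Definition pid x : path_from_to x x := Path (pid_subproof x).

Lemma pcat_subproof x y z (p : path_from_to x y) (q : path_from_to y z) :
  cts_on unit_I (path_concat p q) /\ path_concat p q 0 = x /\ path_concat p q 1 = z.
Proof.
split; last by rewrite concat0 concat1 path0 path1.
by apply: concat_cts; [exact: path_cts|exact: path_cts|rewrite path0 path1].
Qed.
Definition pcat x y z (p : path_from_to x y) (q : path_from_to y z) :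
  path_from_to x z := Path (pcat_subproof p q).

Lemma preverse_subproof x y (p : path_from_to x y) :
  cts_on unit_I (path_rev p) /\ path_rev p 0 = y /\ path_rev p 1 = x.
Proof.
split; first by apply: rev_cts; exact: path_cts.
by rewrite /path_rev subr0 subrr path0 path1.
Qed.
Definition preverse x y (p : path_from_to x y) : path_from_to y x := Path (preverse_subproof p).

Definition homotopic_rel x y : rel (path_from_to x y) :=
  fun p q => `[< path_homotopic p q >].

Lemma homotopic_rel_refl x y : reflexive (@homotopic_rel x y).
Proof. by move=> p; apply/asboolP/homotopic_eq => //; exact: path_cts. Qed.
Lemma homotopic_rel_sym x y : symmetric (@homotopic_rel x y).
Proof. by move=> p q; apply/asboolP/asboolP => /homotopic_sym. Qed.
Lemma homotopic_rel_trans x y : transitive (@homotopic_rel x y).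
Proof.
move=> q p r /asboolP pq /asboolP qr; apply/asboolP.
exact: homotopic_trans pq qr.
Qed.

Canonical homotopic_equiv x y := EquivRel (@homotopic_rel x y)
  (@homotopic_rel_refl x y) (@homotopic_rel_sym x y) (@homotopic_rel_trans x y).

Definition pclass x y := {eq_quot (homotopic_equiv x y)}%qT.

Definition cls x y (p : path_from_to x y) : pclass x y := (\pi_(pclass x y) p)%qT.

Lemma clsP x y (p q : path_from_to x y) : cls p = cls q <-> path_homotopic p q.
Proof.
split; first by move=> /eqmodP /asboolP.
by move=> h; apply/eqmodP/asboolP.
Qed.

Lemma cls_eq x y (p q : path_from_to x y) :
  (forall s, unit_I s -> p s = q s) -> cls p = cls q.
Proof. by move=> pq; apply/clsP/homotopic_eq => //; exact: path_cts. Qed.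

Lemma cls_repr x y (a : pclass x y) : cls (repr a) = a.
Proof. exact: reprK. Qed.

Definition cunit x : pclass x x := cls (pid x).
Definition cmul x y z (a : pclass x y) (b : pclass y z) : pclass x z :=
  cls (pcat (repr a) (repr b)).
Definition cinv x y (a : pclass x y) : pclass y x := cls (preverse (repr a)).

End Groupoid.
Arguments path_cts {R X x y} p.

Notation "a ** b" := (cmul a b) (at level 40, left associativity).

Section GroupoidLaws.
Context {R : realType} {X : topologicalType}.
Implicit Types (x y z w : X).
Local Notation pclass := (@pclass R X).

Lemma cls_cat x y z (p : path_from_to x y) (q : @path_from_to R X y z) :
  cls (pcat p q) = cls p ** cls q.
Proof.
by apply/clsP/homotopic_concat; [apply/clsP; rewrite cls_repr..|rewrite path0 path1].
Qed.

Lemma cls_rev x y (p : @path_from_to R X x y) : cls (preverse p) = cinv (cls p).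
Proof. by apply/clsP/homotopic_rev/clsP; rewrite cls_repr. Qed.

Lemma cmulA x y z w (a : pclass x y) (b : pclass y z) (c : pclass z w) :
  a ** (b ** c) = a ** b ** c.
Proof.
rewrite -(cls_repr a) -(cls_repr b) -(cls_repr c) -!cls_cat; symmetry.
apply/clsP/homotopic_assoc; rewrite ?path0 ?path1//; exact: path_cts.
Qed.

Lemma cmul1c x y (a : pclass x y) : cunit x ** a = a.
Proof.
rewrite -(cls_repr a) -cls_cat; apply/clsP.
have := homotopic_const_l (path_cts (repr a)); by rewrite path0.
Qed.

Lemma cmulc1 x y (a : pclass x y) : a ** cunit y = a.
Proof.
rewrite -(cls_repr a) -cls_cat; apply/clsP.
have := homotopic_const_r (path_cts (repr a)); by rewrite path1.
Qed.

Lemma cmulcV x y (a : pclass x y) : a ** cinv a = cunit x.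
Proof.
rewrite -(cls_repr a) -cls_rev -cls_cat; apply/clsP.
have := homotopic_rev_r (path_cts (repr a)); by rewrite path0.
Qed.

Lemma cmulK x y z (a : pclass x y) (b : pclass y z) : a ** b ** cinv b = a.
Proof. by rewrite -cmulA cmulcV cmulc1. Qed.

Lemma cmulI x y z (a b : pclass x y) (c : pclass y z) : a ** c = b ** c -> a = b.
Proof. by move=> h; rewrite -(cmulK a c) h cmulK. Qed.

Lemma cmulVc x y (a : pclass x y) : cinv a ** a = cunit y.
Proof.
apply: (@cmulI _ _ _ _ _ (cinv a)).
by rewrite -cmulA cmulcV cmulc1 cmul1c.
Qed.

Lemma cmulVK x y z (a : pclass x y) (b : pclass z y) : a ** cinv b ** b = a.
Proof. by rewrite -cmulA cmulVc cmulc1. Qed.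

Lemma cinv_uniq x y (a : pclass x y) (b : pclass y x) : b ** a = cunit y -> b = cinv a.
Proof. by move=> h; apply: (@cmulI _ _ _ _ _ a); rewrite h cmulVc. Qed.

Lemma cinvK x y (a : pclass x y) : cinv (cinv a) = a.
Proof. by symmetry; apply: cinv_uniq; exact: cmulcV. Qed.

Lemma cinvM x y z (a : pclass x y) (b : pclass y z) :
  cinv (a ** b) = cinv b ** cinv a.
Proof. by symmetry; apply: cinv_uniq; rewrite cmulA cmulVK cmulVc. Qed.

Lemma cinv1 x : cinv (@cunit R X x) = cunit x.
Proof. by symmetry; apply: cinv_uniq; rewrite cmul1c. Qed.

Definition ccomm x (a b : pclass x x) : pclass x x := a ** b ** cinv a ** cinv b.

Fixpoint clen x (n : nat) (g : pclass x x) : Prop :=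
  if n is m.+1 then exists a b h, clen m h /\ g = ccomm a b ** h else g = cunit x.

Lemma clenM x m n (g h : pclass x x) : clen m g -> clen n h -> clen (m + n) (g ** h).
Proof.
elim: m g => [|m IH] g /=; first by move=> -> ; rewrite cmul1c.
move=> [a [b [k [mk ->]]]] nh; exists a, b, (k ** h); split; first exact: IH.
by rewrite cmulA.
Qed.

Lemma clen1 x (a b : pclass x x) : clen 1 (ccomm a b).
Proof. by exists a, b, (cunit x); split => //; rewrite cmulc1. Qed.

Lemma ccommV x (a b : pclass x x) : cinv (ccomm a b) = ccomm b a.
Proof. by rewrite /ccomm !cinvM !cinvK !cmulA. Qed.

Lemma clenV x n (g : pclass x x) : clen n g -> clen n (cinv g).
Proof.
elim: n g => [|n IH] g /=; first by move=> ->; rewrite cinv1.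
move=> [a [b [k [nk ->]]]]; rewrite cinvM ccommV -/(clen n.+1 _) -addn1.
by apply: clenM; [exact: IH|exact: clen1].
Qed.

(** The conjugator may join two points, so the lemma also transports commutator length between base
    points. *)
Lemma clen_conj x y n (g : pclass x x) (c : pclass y x) :
  clen n g -> clen n (c ** g ** cinv c).
Proof.
elim: n g => [|n IH] g /=; first by move=> ->; rewrite cmulc1 cmulcV.
move=> [a [b [k [nk ->]]]].
exists (c ** a ** cinv c), (c ** b ** cinv c), (c ** k ** cinv c); split; first exact: IH.
by rewrite /ccomm !cinvM !cinvK !cmulA !cmulVK.
Qed.

Definition in_comm x (g : pclass x x) : Prop := exists n, clen n g.

Lemma in_commM x (g h : pclass x x) : in_comm g -> in_comm h -> in_comm (g ** h).
Proof. by move=> [m mg] [n nh]; exists (m + n)%N; exact: clenM. Qed.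

Lemma in_commV x (g : pclass x x) : in_comm g -> in_comm (cinv g).
Proof. by move=> [m mg]; exists m; exact: clenV. Qed.

Lemma in_comm_conj x y (g : pclass x x) (c : pclass y x) :
  in_comm g -> in_comm (c ** g ** cinv c).
Proof. by move=> [m mg]; exists m; exact: clen_conj. Qed.

End GroupoidLaws.

Section CommutatorLength.
Context {R : realType} {X : topologicalType}.

Lemma path_of_loop (x : X) (f : R -> X) :
  is_path f /\ f 0 = x /\ f 1 = x -> cts_on unit_I f /\ f 0 = x /\ f 1 = x.
Proof. by move=> [/cts_onP]. Qed.

Definition ploop_comm (x : X) (a b : @path_from_to R X x x) :=
  pcat a (pcat b (pcat (preverse a) (preverse b))).

Definition pcomm_prod (x : X) (a b : nat -> @path_from_to R X x x) (r : seq nat) :=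
  foldr (fun i acc => pcat (ploop_comm (a i) (b i)) acc) (pid x) r.

Lemma cls_ploop_comm (x : X) (a b : @path_from_to R X x x) :
  cls (ploop_comm a b) = ccomm (cls a) (cls b).
Proof. by rewrite !cls_cat !cls_rev /ccomm !cmulA. Qed.

Lemma pcomm_prodE (x : X) (a b : nat -> @path_from_to R X x x) (r : seq nat) :
  pcomm_prod a b r = foldr (fun i acc => path_concat (loop_comm (a i) (b i)) acc)
        (const_path x) r :> (R -> X).
Proof. by elim: r => //= i r ->. Qed.

Lemma clen_pcomm_prod (x : X) (a b : nat -> @path_from_to R X x x) (r : seq nat) :
  clen (size r) (cls (pcomm_prod a b r)).
Proof.
elim: r => //= i r IH; exists (cls (a i)), (cls (b i)), (cls (pcomm_prod a b r)).
by split => //; rewrite -cls_ploop_comm -cls_cat.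
Qed.

(** The free starting index [m] serves the induction: the new commutator takes index [m], and the
    remaining ones live on indices above it. *)
Lemma clen_ex_pcomm_prod (x : X) n (g : @pclass R X x x) : clen n g ->
  forall m, exists a b : nat -> @path_from_to R X x x, g = cls (pcomm_prod a b (iota m n)).
Proof.
elim: n g => [|n IH] g /= cg m; first by exists (fun _ => pid x), (fun _ => pid x).
have [c [d [h [ch ->]]]] := cg; have [a [b ->]] := IH h ch m.+1.
exists (fun i => if i == m then repr c else a i),
       (fun i => if i == m then repr d else b i).
rewrite eqxx cls_cat cls_ploop_comm !cls_repr; congr (_ ** cls _).
have : m \notin iota m.+1 n by rewrite mem_iota ltnn.
rewrite /pcomm_prod; elim: (iota _ _) => //= i r IHr.
by rewrite inE negb_or eq_sym => /andP[/negPf -> /IHr ->].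
Qed.

Lemma comm_length_leP (x : X) (l : @path_from_to R X x x) N :
  comm_length_le l N <-> exists2 n, (n <= N)%N & clen n (cls l).
Proof.
split=> [[n [nN [a [b [Ha [Hb H]]]]]]|[n nN /clen_ex_pcomm_prod/(_ 0%N)[a [b H]]]].
  exists n => //; rewrite path0 in Ha Hb H.
  pose a' i := Path (path_of_loop (Ha i)); pose b' i := Path (path_of_loop (Hb i)).
  rewrite -[n in clen n _](size_iota 0 n).
  suff -> : cls l = cls (pcomm_prod a' b' (iota 0 n)) by exact: clen_pcomm_prod.
  by apply/clsP; rewrite pcomm_prodE.
have isl (p : path_from_to x x) : is_path p /\ p 0 = l 0 /\ p 1 = l 0.
  by rewrite !path0 path1; split=> //; apply/cts_onP/path_cts.
exists n; split => //; exists (fun i => a i), (fun i => b i).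
split=> [i|]; first exact: isl.
split=> [i|]; first exact: isl.
by rewrite path0 /comm_prod -pcomm_prodE; apply/clsP.
Qed.

End CommutatorLength.

(** * Singular 1-cycles and the abelianized fundamental group *)

Section Abelianization.
Context {R : realType} {X : topologicalType} (x0 : X).
Local Notation pi1 := (@pclass R X x0 x0).

HB.instance Definition _ := gen_eqMixin (@pclass R X x0 x0).
HB.instance Definition _ := gen_choiceMixin (@pclass R X x0 x0).

Definition comm_coset : rel pi1 := fun g h => `[< in_comm (g ** cinv h) >].

Lemma comm_coset_refl : reflexive comm_coset.
Proof. by move=> g; apply/asboolP; exists 0%N; rewrite cmulcV. Qed.
Lemma comm_coset_sym : symmetric comm_coset.
Proof.
by move=> g h; apply/asboolP/asboolP => /in_commV; rewrite cinvM cinvK.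
Qed.
Lemma comm_coset_trans : transitive comm_coset.
Proof.
move=> h g k /asboolP gh /asboolP hk; apply/asboolP.
by have := in_commM gh hk; rewrite cmulA cmulVK.
Qed.

Canonical comm_coset_equiv := EquivRel comm_coset
  comm_coset_refl comm_coset_sym comm_coset_trans.

Definition pi1ab := {eq_quot comm_coset_equiv}%qT.

Definition toab (g : pi1) : pi1ab := (\pi_pi1ab g)%qT.

Lemma toabP g h : toab g = toab h <-> in_comm (g ** cinv h).
Proof.
split; first by move=> /eqmodP /asboolP.
by move=> gh; apply/eqmodP/asboolP.
Qed.

Definition ab_add (u v : pi1ab) := toab (repr u ** repr v).
Definition ab_opp (u : pi1ab) := toab (cinv (repr u)).

Lemma toab_repr (u : pi1ab) : toab (repr u) = u. Proof. exact: reprK. Qed.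

Lemma ab_addE g h : ab_add (toab g) (toab h) = toab (g ** h).
Proof.
have gg : in_comm (repr (toab g) ** cinv g) by apply/toabP; rewrite toab_repr.
have hh : in_comm (repr (toab h) ** cinv h) by apply/toabP; rewrite toab_repr.
apply/toabP; rewrite cinvM cmulA.
(* Normality of the commutator subgroup: the discrepancy of [h] is conjugated past the
   representative of [g]. *)
have := in_commM (in_comm_conj (repr (toab g)) hh) gg.
by rewrite !cmulA cmulVK.
Qed.

Lemma ab_oppE g : ab_opp (toab g) = toab (cinv g).
Proof.
have gg : in_comm (repr (toab g) ** cinv g) by apply/toabP; rewrite toab_repr.
apply/toabP; rewrite cinvK.
have := in_comm_conj (cinv (repr (toab g))) (in_commV gg).
by rewrite cinvM !cinvK !cmulA cmulVK.
Qed.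

Lemma ab_addA : associative ab_add.
Proof.
move=> u v w; rewrite -(toab_repr u) -(toab_repr v) -(toab_repr w).
by rewrite !ab_addE cmulA.
Qed.
Lemma ab_addC : commutative ab_add.
Proof.
move=> u v; rewrite -(toab_repr u) -(toab_repr v) !ab_addE.
by apply/toabP; exists 1%N; rewrite cinvM cmulA; exact: clen1.
Qed.
Lemma ab_add0 : left_id (toab (cunit x0)) ab_add.
Proof. by move=> u; rewrite -(toab_repr u) ab_addE cmul1c. Qed.
Lemma ab_addN : left_inverse (toab (cunit x0)) ab_opp ab_add.
Proof. by move=> u; rewrite -(toab_repr u) ab_oppE ab_addE cmulVc. Qed.

HB.instance Definition _ := Choice.on pi1ab.
HB.instance Definition _ := GRing.isZmodule.Build pi1ab ab_addA ab_addC ab_add0 ab_addN.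

Lemma toabD g h : toab (g ** h) = toab g + toab h.
Proof. by rewrite -ab_addE. Qed.

Lemma toabN g : toab (cinv g) = - toab g.
Proof. by rewrite -ab_oppE. Qed.

End Abelianization.

Section Chains.
Context {R : realType} {X : topologicalType} {V : zmodType}.
Implicit Types (c : @chain1 R X) (phi : (R -> X) -> V).

Definition chain_eval phi c : V := \sum_(e <- c) phi e.2 *~ e.1.

Definition chain_opp c : @chain1 R X := [seq (- e.1, e.2) | e <- c].

Lemma coef1_cat c1 c2 (p : R -> X) : Defs.coef1 (c1 ++ c2) p = Defs.coef1 c1 p + Defs.coef1 c2 p.
Proof. exact: big_cat. Qed.

Lemma coef1_opp c (p : R -> X) : Defs.coef1 (chain_opp c) p = - Defs.coef1 c p.
Proof.
rewrite /Defs.coef1 big_map -sumrN; apply: eq_bigr => e _ /=.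
by case: ifP; rewrite ?oppr0.
Qed.

Lemma chain_eval_cat phi c1 c2 :
  chain_eval phi (c1 ++ c2) = chain_eval phi c1 + chain_eval phi c2.
Proof. exact: big_cat. Qed.

Lemma chain_eval_opp phi c : chain_eval phi (chain_opp c) = - chain_eval phi c.
Proof. by rewrite /chain_eval big_map -sumrN; apply: eq_bigr => e _ /=; rewrite mulrNz. Qed.

Lemma chain_eval_coef0 phi c :
  (forall p q, agree_on_I p q -> phi p = phi q) ->
  (forall p, Defs.coef1 c p = 0) -> chain_eval phi c = 0.
Proof.
move=> phiE; have [n] := ubnP (size c); elim: n c => // n IH [|[k f] c] /=.
  by rewrite /chain_eval big_nil.
move=> sz c0; set c' := (k, f) :: c.
pose a (e : int * (R -> X)) := `[< agree_on_I e.2 f >].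
have af : a (k, f) by apply/asboolP.
have sgn p : agree_on_I p f -> Defs.coef1 [seq e <- c' | ~~ a e] p = 0.
  move=> pf; rewrite /Defs.coef1 big_filter big1 // => e /negP ne.
  rewrite ifF//; apply/negP => /asboolP ep; apply: ne; apply/asboolP => t It.
  by rewrite ep// pf.
have sgn' p : ~ agree_on_I p f -> Defs.coef1 [seq e <- c' | ~~ a e] p = Defs.coef1 c' p.
  move=> pf; rewrite /Defs.coef1 big_filter [RHS](bigID a) /= [X in _ = X + _]big1 ?add0r//.
  move=> e /asboolP ef; rewrite ifF//; apply/negP => /asboolP ep; apply: pf => t It.
  by rewrite -ep// ef.
rewrite /chain_eval (bigID a) /=.
have -> : \sum_(e <- c' | a e) phi e.2 *~ e.1 = 0.
  rewrite (eq_bigr (fun e => phi f *~ e.1)); last first.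
    by move=> e /asboolP/phiE ->.
  rewrite -mulrz_sumr (_ : \sum_(i <- c' | a i) i.1 = 0) ?mulr0z//.
  by rewrite -[RHS](c0 f) big_mkcond.
rewrite add0r -big_filter; apply: IH.
  rewrite /= af /=; apply: (@leq_ltn_trans (size c)); last by move: sz; rewrite ltnS.
  by rewrite size_filter count_size.
move=> p; have [pf|pf] := pselect (agree_on_I p f); first exact: sgn.
by rewrite sgn'.
Qed.

End Chains.

(** * From homologous loops to products of commutators *)

Section Hurewicz.
Context {R : realType} {X : topologicalType} (x0 : X).
Context (conn : @path_connected_set R X [set: X]).

Lemma tail_ex (y : X) : exists p : @path_from_to R X x0 y, True.
Proof.
have [f [cf [f0 [f1 _]]]] := @conn x0 y I I.
by exists (Path (conj ((cts_onP _ _).1 cf) (conj f0 f1))).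
Qed.

(* A path from the base point to each vertex turns edges into loops. *)
Definition tail (y : X) : @pclass R X x0 y := cls (sval (cid (tail_ex y))).

(** The value 0 at discontinuous maps extends the class to all functions, as [chain_eval] expects;
    such maps do not occur in the chains evaluated. *)
Definition edge_cls (f : R -> X) : pi1ab x0 :=
  match pselect (cts_on unit_I f) with
  | left h => toab (tail (f 0) ** cls (Path (conj h (conj erefl erefl)))
                      ** cinv (tail (f 1)))
  | right _ => 0
  end.

Lemma edge_clsE y z (p : @path_from_to R X y z) (f : R -> X) :
  (forall t, unit_I t -> f t = p t) ->
  edge_cls f = toab (tail y ** cls p ** cinv (tail z)).
Proof.
move=> fp; have cf : cts_on unit_I f.
  by apply: cts_on_eq (path_cts p) => t /fp.
have f0 : f 0 = y by rewrite fp ?path0//; exact: unit0.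
have f1 : f 1 = z by rewrite fp ?path1//; exact: unit1.
subst y z; rewrite /edge_cls; case: pselect => // h.
by congr (toab (_ ** _ ** _)); apply: cls_eq.
Qed.

Lemma edge_cls_agree f g : agree_on_I f g -> edge_cls f = edge_cls g.
Proof.
move=> fg; have [cg|ncg] := pselect (cts_on unit_I g).
  pose p : path_from_to (g 0) (g 1) := Path (conj cg (conj erefl erefl)).
  by rewrite (@edge_clsE _ _ p f) ?(@edge_clsE _ _ p g).
rewrite /edge_cls; case: pselect => [cf|_]; case: pselect => // _.
by case: ncg; apply: cts_on_eq cf.
Qed.

(** In each triangle the middle face is homotopic to the product of the other two, and the tails at
    the shared vertex cancel. *)
Lemma edge_cls_bd2 (w : @chain2 R X) : is_chain2 w -> chain_eval edge_cls (bd2 w) = 0.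
Proof.
elim: w => [|[k s] w IH] Hw; first by rewrite /chain_eval big_nil.
rewrite /bd2 /= -/(bd2 w) /chain_eval !big_cons -/(chain_eval _ _) IH ?addr0; last first.
  by move=> e ew; apply: Hw; rewrite inE ew orbT.
have /cts_onP cs : {within simplex2, continuous s}.
  by apply: (Hw (k, s)); rewrite inE eqxx.
have c0 : cts_on unit_I (face0 s) /\ face0 s 0 = s (1, 0) /\ face0 s 1 = s (0, 1).
  rewrite /face0 subr0 subrr; split => //; apply: (cts_on_comp cs); first by cts.
  by move=> t; rewrite /unit_I /simplex2 /=; lra.
have c1 : cts_on unit_I (face1 s) /\ face1 s 0 = s (0, 0) /\ face1 s 1 = s (0, 1).
  split => //; apply: (cts_on_comp cs); first by apply: cts_on_pair; cts.
  by move=> t; rewrite /unit_I /simplex2 /=; lra.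
have c2 : cts_on unit_I (face2 s) /\ face2 s 0 = s (0, 0) /\ face2 s 1 = s (1, 0).
  split => //; apply: (cts_on_comp cs); first by cts.
  by move=> t; rewrite /unit_I /simplex2 /=; lra.
rewrite (@edge_clsE _ _ (Path c0))// (@edge_clsE _ _ (Path c1))// (@edge_clsE _ _ (Path c2))//.
have -> : cls (Path c1) = cls (Path c2) ** cls (Path c0).
  by rewrite -cls_cat; symmetry; apply/clsP; exact: homotopic_simplex2.
have -> : toab (tail (s (0, 0)) ** (cls (Path c2) ** cls (Path c0)) ** cinv (tail (s (0, 1)))) =
    toab (tail (s (0, 0)) ** cls (Path c2) ** cinv (tail (s (1, 0)))) +
    toab (tail (s (1, 0)) ** cls (Path c0) ** cinv (tail (s (0, 1)))).
  by rewrite -toabD !cmulA cmulVK.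
by rewrite mulrNz mulrzDl opprD addrAC addNr add0r addrN.
Qed.

(** The chain [p - q - bd2 w] has zero coefficients, so its value under [edge_cls] is 0, and so is
    that of [bd2 w]. The tails at [x0] only conjugate, which the abelianization ignores. *)
Lemma homologous_in_comm (p q : @path_from_to R X x0 x0) :
  homologous [:: (1 : int, p : R -> X)] [:: (1 : int, q : R -> X)] ->
  in_comm (cls p ** cinv (cls q)).
Proof.
move=> [w [cw Hw]]; apply/toabP.
have := @chain_eval_coef0 _ _ _ edge_cls
  ([:: (1 : int, p : R -> X)] ++ chain_opp [:: (1 : int, q : R -> X)] ++ chain_opp (bd2 w)).
rewrite !chain_eval_cat !chain_eval_opp edge_cls_bd2// subr0 => /(_ edge_cls_agree).
rewrite /chain_eval !big_seq1 !mulr1z => /(_ _)/subr0_eq E.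
have {E} : edge_cls p = edge_cls q.
  by apply: E => f; rewrite !coef1_cat !coef1_opp -Hw; ring.
have conj0 (g : @pclass R X x0 x0) : toab (tail x0 ** g ** cinv (tail x0)) = toab g.
  by rewrite toabD toabD toabN addrAC subrr add0r.
by rewrite (@edge_clsE _ _ p)// (@edge_clsE _ _ q)// !conj0.
Qed.

End Hurewicz.

(** * Uniform limits and step functions *)

Section Metric.
Context {R : realType} {X : topologicalType} (d : X -> X -> R).
Context (dX : compatible_metric d).

Let d_ge0 x y : 0 <= d x y. Proof. exact: dX.1.1. Qed.
Let dxx x : d x x = 0. Proof. exact/dX.1.2.1. Qed.
Let dC x y : d x y = d y x. Proof. exact: dX.1.2.2.1. Qed.
Let dT x y z : d x z <= d x y + d y z. Proof. exact: dX.1.2.2.2. Qed.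

Definition shrink (n : nat) : R := n.+1%:R^-1.

Lemma shrink_gt0 n : 0 < shrink n. Proof. by rewrite invr_gt0 ltr0n. Qed.

Lemma shrink_mono m n : (m <= n)%N -> shrink n <= shrink m.
Proof. by move=> mn; rewrite lef_pV2 ?posrE ?ltr0n// ler_nat ltnS. Qed.

Lemma shrink_small (e : R) : 0 < e -> exists n, forall m, (n <= m)%N -> shrink m < e.
Proof.
move=> e0; exists (Num.truncn e^-1) => m nm.
have /truncn_itv/andP[_ h] : 0 <= e^-1 by rewrite invr_ge0 ltW.
rewrite -[e]invrK ltf_pV2 ?posrE ?ltr0n ?invr_gt0//.
by apply: lt_le_trans h _; rewrite ler_nat ltnS.
Qed.

Lemma le_shrink0 (a C : R) : 0 <= C -> (forall k, a <= C * shrink k) -> a <= 0.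
Proof.
move=> C0 H; rewrite leNgt; apply/negP => a0.
have C1 : 0 < C + 1 by lra.
have [n /(_ n (leqnn n))] := shrink_small (divr_gt0 a0 C1).
rewrite ltr_pdivlMr// => h; have := H n; have := shrink_gt0 n; nra.
Qed.

Lemma metric_eq (x y : X) (C : R) : 0 <= C -> (forall k, d x y <= C * shrink k) -> x = y.
Proof.
move=> C0 /(le_shrink0 C0) h; apply/(dX.1.2.1 x y)/eqP.
by rewrite eq_le h d_ge0.
Qed.

Lemma nbhs_metric (x : X) (A : set X) :
  nbhs x A <-> exists2 e : R, 0 < e & [set y | d x y < e] `<=` A.
Proof.
split=> [|[e e0 eA]].
  rewrite nbhsE => -[B [oB Bx] BA]; have [e e0 eB] := (dX.2 B).1 oB x Bx.
  by exists e => //; exact: subset_trans eB BA.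
rewrite nbhsE; exists [set y | d x y < e] => //; split; last by rewrite /= dxx.
apply/(dX.2 _).2 => y /= xy; exists (e - d x y); first by rewrite subr_gt0.
by move=> z /= yz; have := dT x y z; lra.
Qed.

Lemma cts_on_metric (T : topologicalType) (D : set T) (f : T -> X) :
  cts_on D f <-> (forall x, D x -> forall e : R, 0 < e ->
    \forall y \near x, D y -> d (f x) (f y) < e).
Proof.
split=> [cf x Dx e e0|H x Dx A /nbhs_metric[e e0 eA]].
  have /cf : nbhs (f x) [set y | d (f x) y < e] by apply/nbhs_metric; exists e.
  by move=> /(_ Dx); rewrite !nbhs_simpl.
have := H x Dx e e0; rewrite !nbhs_simpl /within /=.
by apply: filterS => y h Dy; apply: eA; exact: h.
Qed.

Context (cX : compact [set: X]).

Lemma compact_complete (u : nat -> X) (C : R) : 0 <= C ->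
  (forall k j, (k <= j)%N -> d (u k) (u j) <= C * shrink k) ->
  exists l, forall k, d (u k) l <= C * shrink k.
Proof.
move=> C0 H; have [l [_ cl]] := cX (fmap_proper_filter u eventually_filter) filterT.
exists l => k; apply/ler_addgt0Pr => e e0.
have [||v [[j kj <-] vl]] := cl (u @` [set j | (k <= j)%N]) [set y | d l y < e].
- by exists k => // j kj; exists j.
- by apply/nbhs_metric; exists e.
have := H k j kj; have := dT (u k) (u j) l; move: vl; rewrite /= dC; lra.
Qed.

Lemma uniform_limit (T : topologicalType) (D : set T) (f : nat -> T -> X) (C : R) :
  0 <= C -> (forall k, cts_on D (f k)) ->
  (forall k j t, (k <= j)%N -> D t -> d (f k t) (f j t) <= C * shrink k) ->
  exists g, cts_on D g /\ forall k t, D t -> d (f k t) (g t) <= C * shrink k.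
Proof.
move=> C0 cf H.
have Hlim t : exists l, D t -> forall k, d (f k t) l <= C * shrink k.
  have [Dt|nD] := pselect (D t); last by exists (f 0 t).
  by have [l Hl] := compact_complete C0 (fun k j kj => H k j t kj Dt); exists l.
have [g Hg] := choice Hlim; exists g; split; last by move=> k t Dt; exact: Hg.
apply/cts_on_metric => t Dt e e0.
have [k Hk] : exists k, C * shrink k < e / 3.
  have C1 : 0 < C + 1 by lra.
  have e3 : 0 < e / 3 by lra.
  have [n /(_ n (leqnn n))] := shrink_small (divr_gt0 e3 C1).
  by rewrite ltr_pdivlMr// => h; exists n; have := shrink_gt0 n; nra.
have e3 : 0 < e / 3 by lra.
have := (cts_on_metric _ _).1 (cf k) t Dt (e / 3) e3.
apply: filterS => s /[swap] Ds /(_ Ds) h.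
have := Hg t Dt k; have := Hg s Ds k; have := dT (g t) (f k t) (g s).
by have := dT (f k t) (f k s) (g s); rewrite (dC (g t) (f k t)); lra.
Qed.

(** Without a finite net the complements of finite unions of balls generate a proper filter, and a
    cluster point [p] of it would have to be avoided by its own ball. *)
Lemma finite_net (e : R) : 0 < e -> exists z : seq X, forall y, exists2 c, c \in z & d c y < e.
Proof.
move=> e0; apply: contrapT => nz.
pose B (z : seq X) : set X := [set y | forall c, c \in z -> e <= d c y].
pose F : set_system X := [set A | exists z, B z `<=` A].
have FF : ProperFilter F.
  split; last split.
  - move=> [z Bz]; apply: nz; exists z => y; apply: contrapT => ny.
    by apply: (Bz y) => c cz; rewrite leNgt; apply/negP => h; apply: ny; exists c.
  - by exists [::].
  - move=> P Q [z zP] [w wQ]; exists (z ++ w) => y By; split.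
      by apply: zP => c cz; apply: By; rewrite mem_cat cz.
    by apply: wQ => c cz; apply: By; rewrite mem_cat cz orbT.
  - by move=> P Q PQ [z zP]; exists z; exact: subset_trans zP PQ.
have [p [_ cp]] := cX FF filterT.
have [||y [/(_ p)]] := cp (B [:: p]) [set y | d p y < e].
- by exists [:: p].
- by apply/nbhs_metric; exists e.
by rewrite mem_seq1 eqxx /= leNgt => /(_ isT)/negP.
Qed.

Lemma compact_unit_sq : compact (@unit_sq R).
Proof.
have -> : @unit_sq R = `[0, 1]%classic `*` `[0, 1]%classic.
  apply/seteqP; split => -[s t] /=; rewrite /unit_sq /unit_I /= !in_itv /= => -[];
    by [].
by apply: compact_setX; exact: segment_compact.
Qed.

Lemma uniformly_cts (H : R * R -> X) (e : R) : cts_on unit_sq H -> 0 < e ->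
  exists n, forall p q, unit_sq p -> unit_sq q ->
    `|p.1 - q.1| < shrink n -> `|p.2 - q.2| < shrink n -> d (H p) (H q) < e.
Proof.
move=> cH e0; have /compact_near_coveringP ncov := compact_unit_sq.
pose P n (p : R * R) := forall q, unit_sq p -> unit_sq q ->
    `|p.1 - q.1| < shrink n -> `|p.2 - q.2| < shrink n -> d (H p) (H q) < e.
have [p Dp|n _ Hn] := ncov nat \oo P _; last first.
  by exists n => p q Dp; apply: (Hn n (leqnn n) p Dp).
- have e2 : 0 < e / 2 by lra.
  have /nbhs_ballP[dl /= dl0 Hdl] := (cts_on_metric _ _).1 cH p Dp _ e2.
  have dl2 : 0 < dl / 2 by lra.
  have [m Hm] := shrink_small dl2.
  exists (ball p (dl / 2), [set n | (m <= n)%N]) => /=.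
    by split; [exact: nbhsx_ballx|exists m].
  move=> [p' n] /= [[bp1 bp2] mn] q Dp' Dq q1 q2.
  have rn := Hm n mn.
  have h1 : d (H p) (H p') < e / 2.
    apply: Hdl => //; split; rewrite /ball /=; [apply: lt_le_trans bp1 _|apply: lt_le_trans bp2 _]; lra.
  have h2 : d (H p) (H q) < e / 2.
    apply: Hdl => //; split; rewrite /ball /=.
      by have := ler_distD p'.1 p.1 q.1; move: bp1; rewrite /ball /=; lra.
    by have := ler_distD p'.2 p.2 q.2; move: bp2; rewrite /ball /=; lra.
  by have := dT (H p') (H p) (H q); rewrite (dC (H p') (H p)); lra.
Qed.

Context (x0 : X).

(** The number [k] codes a grid size and a table of indices into the net. These maps need not be
    continuous; they only serve as a countable set of centres for the uniform distance. *)
Definition step_fun (z : seq X) (k : nat) (p : R * R) : X :=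
  let: (g, w) := odflt (0%N, [::]) (unpickle k : option (nat * seq (seq nat))) in
  nth x0 z (nth 0%N (nth [::] w (Num.truncn (p.1 * g.+1%:R))) (Num.truncn (p.2 * g.+1%:R))).

Lemma truncn_cell (n : nat) (t : R) : unit_I t ->
  let i := Num.truncn (t * n.+1%:R) in
  [/\ (i <= n.+1)%N, unit_I (i%:R * shrink n) & `|i%:R * shrink n - t| < shrink n].
Proof.
move=> /andP[t0 t1] i; have n0 : 0 < n.+1%:R :> R by rewrite ltr0n.
have /truncn_itv : 0 <= t * n.+1%:R by rewrite mulr_ge0// ltW.
rewrite -/i => /andP[h1 h2].
have it : i%:R * shrink n <= t by rewrite ler_pdivrMr.
split.
- rewrite -(ler_nat R); apply: le_trans h1 _.
  by rewrite -[leRHS]mul1r ler_pM2r.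
- by rewrite /unit_I /= (le_trans it t1) andbT mulr_ge0// ltW// shrink_gt0.
- rewrite ler0_norm ?subr_le0// opprB ltrBlDr -[X in X + _]mul1r -mulrDl.
  by rewrite /shrink ltr_pdivlMr// addrC natr1.
Qed.

Lemma step_fun_dense (e : R) (z : seq X) :
  (forall y, exists2 c, c \in z & d c y < e / 2) ->
  forall H, cts_on unit_sq H ->
  exists k, forall p, unit_sq p -> d (H p) (step_fun z k p) < e.
Proof.
move=> Hz H cH.
have e0 : 0 < e / 2.
  by have [c _ /le_lt_trans] := Hz x0; apply.
have [n Hn] := uniformly_cts cH e0.
have idx (ij : nat * nat) : exists a : nat,
    d (H (ij.1%:R * shrink n, ij.2%:R * shrink n)) (nth x0 z a) < e / 2.
  have [c cz dc] := Hz (H (ij.1%:R * shrink n, ij.2%:R * shrink n)).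
  by exists (index c z); rewrite nth_index// dC.
have [a Ha] := choice idx.
(* The size is [n.+2] because the coordinate 1 falls in the cell of index [n.+1]. *)
pose w := mkseq (fun i => mkseq (fun j => a (i, j)) n.+2) n.+2.
exists (pickle (n, w)) => p [p1 p2].
rewrite /step_fun pickleK /=.
have [i1 i2 i3] := truncn_cell n p1; have [j1 j2 j3] := truncn_cell n p2.
move: i1 i2 i3 j1 j2 j3; set i := Num.truncn _; set j := Num.truncn _ => i1 i2 i3 j1 j2 j3.
rewrite nth_mkseq ?ltnS// nth_mkseq ?ltnS//.
have := Hn (i%:R * shrink n, j%:R * shrink n) p (conj i2 j2) (conj p1 p2) i3 j3.
have := Ha (i, j) => /=; set c := H (_, _).
by have := dT (H p) c (nth x0 z (a (i, j))); rewrite (dC (H p) c); lra.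
Qed.

End Metric.

(** * Infinite concatenations of small loops *)

Section InfiniteConcatenation.
Context {R : realType} {X : topologicalType} (d : X -> X -> R).
Context (dX : compatible_metric d).
Context (cX : compact [set: X]).
Context (x : X).
Local Notation loop := (@path_from_to R X x x).

Let dxx y : d y y = 0. Proof. exact/dX.1.2.1. Qed.
Let dC y z : d y z = d z y. Proof. exact: dX.1.2.2.1. Qed.
Let dT y z w : d y w <= d y z + d z w. Proof. exact: dX.1.2.2.2. Qed.

Lemma path_concat_ind (P : R -> X -> X -> Prop) (p p' q q' : R -> X) :
  (forall s, unit_I s -> forall t, P t (p s) (p' s)) ->
  (forall s, unit_I s -> forall t, P t (q s) (q' s)) ->
  forall s, unit_I s -> P s (path_concat p q s) (path_concat p' q' s).
Proof.
move=> Hp Hq s; rewrite /unit_I /= => Is; rewrite /path_concat.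
by case: (lerP s 2^-1) => hs; [apply: Hp|apply: Hq]; rewrite /unit_I /=; lra.
Qed.

Lemma dist_concat (p p' q q' : R -> X) (e : R) :
  (forall s, unit_I s -> d (p s) (p' s) <= e) ->
  (forall s, unit_I s -> d (q s) (q' s) <= e) ->
  forall s, unit_I s -> d (path_concat p q s) (path_concat p' q' s) <= e.
Proof.
move=> Hp Hq s Is; apply: (@path_concat_ind (fun _ y z => d y z <= e)) => // t It _.
  exact: Hp.
exact: Hq.
Qed.

(** Nesting to the right puts [l k] on an interval of length [2^-(k+1)], the same in all longer
    partial products. *)
Fixpoint partial_concat (n : nat) (l : nat -> loop) : loop :=
  if n is m.+1 then pcat (l 0%N) (partial_concat m (fun k => l k.+1)) else pid x.

Lemma partial_concat_close (e : R) m n (l : nat -> loop) : (m <= n)%N -> 0 <= e ->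
  (forall k s, (m <= k)%N -> unit_I s -> d x (l k s) <= e) ->
  forall s, unit_I s -> d (partial_concat m l s) (partial_concat n l s) <= e.
Proof.
move=> + e0; elim: n m l => [|n IH] [|m] l //= mn Hl s Is.
- by rewrite dxx.
(* Split in two, the constant path can be compared with a concatenation half by half. *)
- have xx t : const_path x t = path_concat (const_path x) (@const_path R X x) t.
    by rewrite /path_concat /const_path; case: ifP.
  rewrite xx; apply: dist_concat => // t It; first exact: Hl.
  by apply: (IH 0%N (fun k => l k.+1)) => // k u _; exact: Hl.
- apply: dist_concat => // t It; first by rewrite dxx.
  by apply: IH => // k u mk; exact: Hl.
Qed.

Definition small_loops (l : nat -> loop) : Prop :=
  forall k s, unit_I s -> d x (l k s) <= shrink k.

Lemma small_loops_shift l : small_loops l -> small_loops (fun k => l k.+1).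
Proof. by move=> sl k s Is; apply: le_trans (sl _ _ Is) _; exact: shrink_mono. Qed.

(** The explicit rate determines [L] on the unit interval and makes [L] depend continuously on the
    choice of loops. *)
Definition inf_concat (l : nat -> loop) (L : loop) : Prop :=
  forall n s, unit_I s -> d (partial_concat n l s) (L s) <= shrink n.

Lemma inf_concat_ex l : small_loops l -> exists L, inf_concat l L.
Proof.
move=> sl.
have [||k j t kj It|g [cg Hg]] :=
  @uniform_limit _ _ _ dX cX _ (@unit_I R) (fun n => partial_concat n l) 1.
- by [].
- by move=> k; exact: path_cts.
- rewrite mul1r; apply: partial_concat_close => //; first exact/ltW/shrink_gt0.
  by move=> i s ki Is; apply: le_trans (sl _ _ Is) _; exact: shrink_mono.
have g0 : g 0 = x.
  apply/esym/(metric_eq dX (@ler01 R)) => k.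
  by have := Hg k 0 unit0; rewrite path0.
have g1 : g 1 = x.
  apply/esym/(metric_eq dX (@ler01 R)) => k.
  by have := Hg k 1 unit1; rewrite path1.
exists (Path (conj cg (conj g0 g1))) => n s Is.
by have := Hg n s Is; rewrite mul1r.
Qed.

(** Both sides are limits of the same partial products, hence equal as maps on the interval. *)
Lemma inf_concatS l L L' : inf_concat l L -> inf_concat (fun k => l k.+1) L' ->
  cls L = cls (l 0%N) ** cls L'.
Proof.
move=> HL HL'; rewrite -cls_cat; apply: cls_eq => s Is.
apply: (metric_eq dX (ler0n R 2)) => k.
have h : d (partial_concat k.+1 l s) (pcat (l 0%N) L' s) <= shrink k.
  apply: dist_concat => // t It; last exact: HL'.
  by rewrite dxx ltW// shrink_gt0.
have := HL k.+1 s Is; have := @shrink_mono R _ _ (leqnSn k).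
have := dT (L s) (partial_concat k.+1 l s) (pcat (l 0%N) L' s).
by rewrite (dC (L s) (partial_concat _ _ _)); lra.
Qed.

(** Peeling off the common loops before [m] builds the conjugator [g]. At [m] both products continue
    with the same infinite tail, which cancels. *)
Lemma inf_concat_flip m (l l' : nat -> loop) L L' : small_loops l -> small_loops l' ->
  inf_concat l L -> inf_concat l' L' ->
  (forall k, k != m -> l k = l' k) -> l' m = pid x ->
  exists g : pclass x x, cls L ** cinv (cls L') = g ** cls (l m) ** cinv g.
Proof.
elim: m l l' L L' => [|m IH] l l' L L' sl sl' HL HL' ll' l'm.
  have [T HT] := inf_concat_ex (small_loops_shift sl).
  have ll : (fun k => l k.+1) = (fun k => l' k.+1) by apply/funext => k; exact: ll'.
  exists (cunit x); rewrite (inf_concatS HL HT) (inf_concatS HL' (L' := T)) -?ll//.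
  by rewrite l'm -/(cunit x) cmul1c cmulK cmul1c cinv1 cmulc1.
have [T HT] := inf_concat_ex (small_loops_shift sl).
have [T' HT'] := inf_concat_ex (small_loops_shift sl').
have [g Hg] := IH _ _ _ _ (small_loops_shift sl) (small_loops_shift sl') HT HT'
  (fun k km => ll' k.+1 km) l'm.
exists (cls (l 0%N) ** g).
rewrite (inf_concatS HL HT) (inf_concatS HL' HT') -ll'// !cinvM !cmulA.
by rewrite -(cmulA _ (cls T)) Hg !cmulA.
Qed.

Lemma partial_concat_eq n (l l' : nat -> loop) : (forall k, (k < n)%N -> l k = l' k) ->
  partial_concat n l = partial_concat n l'.
Proof.
elim: n l l' => //= n IH l l' ll'; rewrite ll'//; congr pcat.
by apply: IH => k kn; exact: ll'.
Qed.

Lemma inf_concat_close n l l' L L' : inf_concat l L -> inf_concat l' L' ->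
  (forall k, (k < n)%N -> l k = l' k) ->
  forall s, unit_I s -> d (L s) (L' s) <= 2 * shrink n.
Proof.
move=> HL HL' /partial_concat_eq ll' s Is.
have := HL n s Is; have := HL' n s Is; have := dT (L s) (partial_concat n l s) (L' s).
by rewrite (dC (L s) (partial_concat _ _ _)) ll'; lra.
Qed.

Lemma concat_limit (C : R) (p q : nat -> loop) (f : R -> X) : 0 <= C ->
  cts_on unit_I f ->
  (forall k s, unit_I s -> d (path_concat (p k) (q k) s) (f s) <= C * shrink k) ->
  exists p' q' : loop, [/\ forall s, unit_I s -> f s = path_concat p' q' s,
    forall k s, unit_I s -> d (p k s) (p' s) <= C * shrink k &
    forall k s, unit_I s -> d (q k s) (q' s) <= C * shrink k].
Proof.
move=> C0 cf Hf.
have hp k s : unit_I s -> d (p k s) (f (s / 2)) <= C * shrink k.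
  rewrite /unit_I /= => Is; have := Hf k (s / 2); rewrite /path_concat ifT; last lra.
  rewrite (_ : 2 * (s / 2) = s); last by lra.
  by apply; rewrite /unit_I /=; lra.
have hq k s : unit_I s -> d (q k s) (f ((s + 1) / 2)) <= C * shrink k.
  (* The midpoint belongs to the first half of [path_concat], so the start of [q k] is controlled
     through the end of [p k]. *)
  rewrite /unit_I /= => Is; have [->|s0] := eqVneq s 0.
    rewrite path0 -(path1 (p k)) add0r; apply: hp; exact: unit1.
  have := Hf k ((s + 1) / 2); rewrite /path_concat ifF; last first.
    apply/negbTE; rewrite -ltNge; have : 0 < s by rewrite lt_def s0; lra.
    by lra.
  rewrite (_ : 2 * ((s + 1) / 2) - 1 = s); last by lra.
  by apply; rewrite /unit_I /=; lra.
have cp' : cts_on unit_I (fun s => f (s / 2)).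
  apply: (cts_on_comp cf); first by apply: cts_onM; cts.
  by move=> s; rewrite /unit_I /=; lra.
have cq' : cts_on unit_I (fun s => f ((s + 1) / 2)).
  apply: (cts_on_comp cf); first by cts.
  by move=> s; rewrite /unit_I /=; lra.
have p0 : f (0 / 2) = x.
  by apply/esym/(metric_eq dX C0) => k; rewrite -(path0 (p k)); apply: hp; exact: unit0.
have p1 : f (1 / 2) = x.
  by apply/esym/(metric_eq dX C0) => k; rewrite -(path1 (p k)); apply: hp; exact: unit1.
have q0 : f ((0 + 1) / 2) = x by rewrite add0r.
have q1 : f ((1 + 1) / 2) = x.
  by apply/esym/(metric_eq dX C0) => k; rewrite -(path1 (q k)); apply: hq; exact: unit1.
exists (Path (conj cp' (conj p0 p1))), (Path (conj cq' (conj q0 q1))); split => //= s Is.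
rewrite /path_concat; case: ifP => _; congr f; lra.
Qed.

Lemma loop_limit_eq (C : R) (p : nat -> loop) (f g : R -> X) : 0 <= C ->
  (forall k s, unit_I s -> d (p k s) (f s) <= C * shrink k) ->
  (forall k s, unit_I s -> d (p k s) (g s) <= C * shrink k) ->
  forall s, unit_I s -> f s = g s.
Proof.
move=> C0 Hf Hg s Is.
apply: (@metric_eq _ _ d dX _ _ (2 * C)) => [|k]; first by rewrite mulr_ge0.
have := Hf k s Is; have := Hg k s Is; have := dT (f s) (p k s) (g s).
by rewrite (dC (f s) (p k s)); lra.
Qed.

Lemma path_concat_eq (p p' q q' : R -> X) :
  (forall s, unit_I s -> p s = p' s) -> (forall s, unit_I s -> q s = q' s) ->
  forall s, unit_I s -> path_concat p q s = path_concat p' q' s.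
Proof.
move=> Hp Hq s Is; apply: (@path_concat_ind (fun _ y z => y = z)) => // t It _.
  exact: Hp.
exact: Hq.
Qed.

(* Every letter can be read off from the values of the product, so the letters converge too. *)
Lemma pcomm_prod_limit (C : R) (r : seq nat) (a b : nat -> nat -> loop) (f : R -> X) :
  0 <= C -> uniq r -> cts_on unit_I f ->
  (forall k s, unit_I s -> d (pcomm_prod (a k) (b k) r s) (f s) <= C * shrink k) ->
  exists a' b' : nat -> loop, forall s, unit_I s -> f s = pcomm_prod a' b' r s.
Proof.
move=> C0; elim: r f => [|i r IH] f /= => [_ cf Hf|/andP[ir ur] cf Hf].
  exists (fun _ => pid x), (fun _ => pid x) => s Is.
  by apply/esym/(metric_eq dX C0) => k; exact: Hf.
have [c [g [fE Hc Hg]]] := concat_limit (p := fun k => ploop_comm (a k i) (b k i)) 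
  (q := fun k => pcomm_prod (a k) (b k) r) C0 cf Hf.
have [a' [b' gE]] := IH g ur (path_cts g) Hg.
have [a0 [c1 [cE Ha Hc1]]] := concat_limit (p := fun k => a k i) 
  (q := fun k => pcat (b k i) (pcat (preverse (a k i)) (preverse (b k i)))) C0 (path_cts c) Hc.
have [b0 [c2 [c1E Hb Hc2]]] := concat_limit (p := fun k => b k i) 
  (q := fun k => pcat (preverse (a k i)) (preverse (b k i))) C0 (path_cts c1) Hc1.
have [a1 [b1 [c2E Ha1 Hb1]]] := concat_limit (p := fun k => preverse (a k i)) 
  (q := fun k => preverse (b k i)) C0 (path_cts c2) Hc2.
have rI s : unit_I s -> unit_I (1 - s) by rewrite /unit_I /=; lra.
(* The third and fourth letters have limits of their own; uniqueness of limits identifies them with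
   the reverses of the first two. *)
have a1E : forall s, unit_I s -> a1 s = preverse a0 s.
  by apply: (loop_limit_eq C0 Ha1) => k s /rI; exact: Ha.
have b1E : forall s, unit_I s -> b1 s = preverse b0 s.
  by apply: (loop_limit_eq C0 Hb1) => k s /rI; exact: Hb.
exists (fun k => if k == i then a0 else a' k), (fun k => if k == i then b0 else b' k).
move=> s Is; rewrite fE// /= eqxx.
apply: path_concat_eq => // {s Is} s Is.
  rewrite cE// /=; apply: path_concat_eq => // {s Is} s Is.
  rewrite c1E// /=; apply: path_concat_eq => // {s Is} s Is.
  by rewrite c2E//; apply: path_concat_eq.
rewrite gE//; move: ir; rewrite /pcomm_prod.
elim: {ur IH Hf gE Hg} r s Is => //= j r IHr s Is.
rewrite inE negb_or eq_sym => /andP[/negPf -> ir].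
by apply: path_concat_eq => // t It; exact: IHr.
Qed.

End InfiniteConcatenation.

(** * The commutator relation on the Cantor square and its tree of homotopies *)

Section SmallLoops.
Context {R : realType} {X : topologicalType} (d : X -> X -> R).
Context (dX : compatible_metric d).
Context (cX : compact [set: X]).
Context (x : X) (l : nat -> @path_from_to R X x x).
Context (sl : small_loops d l).
Local Notation loop := (@path_from_to R X x x).

Let dC y z : d y z = d z y. Proof. exact: dX.1.2.2.1. Qed.
Let dT y z w : d y w <= d y z + d z w. Proof. exact: dX.1.2.2.2. Qed.

Definition select (a : cantor) (k : nat) : loop := if a k then l k else pid x.

Lemma select_small (a : cantor) : small_loops d (select a).
Proof.
move=> k s Is; rewrite /select; case: (a k); first exact: sl.
by rewrite /= /const_path (dX.1.2.1 x x).2// ltW// shrink_gt0.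
Qed.

Context (L : cantor -> loop).
Context (HL : forall a, inf_concat d (select a) (L a)).

Definition quotient_loop (p : cantor * cantor) : loop :=
  pcat (L p.1) (preverse (L p.2)).

Lemma quotient_loop_close k p q : restr p.1 k = restr q.1 k -> restr p.2 k = restr q.2 k ->
  forall s, unit_I s -> d (quotient_loop p s) (quotient_loop q s) <= 2 * shrink k.
Proof.
have sel (a b : cantor) : restr a k = restr b k ->
    forall s, unit_I s -> d (L a s) (L b s) <= 2 * shrink k.
  move=> ab; apply: (inf_concat_close dX (HL a) (HL b)) => i ik.
  by rewrite /select -(nth_restr a ik) ab nth_restr.
move=> h1 h2; apply: dist_concat => s Is; first exact: sel.
by apply: sel => //; move: Is; rewrite /unit_I /=; lra.
Qed.

(** The common factor [L b] cancels between the two quotients, which costs [n + n] commutators and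
    leaves a conjugate of [l m] or of its inverse. *)
Lemma clen_flip (a b : cantor) n m :
  clen n (cls (quotient_loop (a, b))) -> clen n (cls (quotient_loop (flip_at m a, b))) ->
  clen (n + n) (cls (l m)).
Proof.
rewrite !cls_cat !cls_rev /= => ca cb.
have {ca cb} : clen (n + n) (cls (L a) ** cinv (cls (L (flip_at m a)))).
  by have := clenM ca (clenV cb); rewrite cinvM cinvK cmulA cmulVK.
have flipK (c : cantor) : c m -> clen (n + n) (cls (L c) ** cinv (cls (L (flip_at m c)))) ->
    clen (n + n) (cls (l m)).
  move=> cm; have [||k km||g ->] := inf_concat_flip dX cX _ _ (HL c) (HL (flip_at m c)) (m := m).
  - exact: select_small.
  - exact: select_small.
  - by rewrite /select /flip_at (negPf km).
  - by rewrite /select /flip_at eqxx cm.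
  rewrite {1}/select cm => /(clen_conj (cinv g)).
  by rewrite cinvK !cmulA cmulVc cmul1c cmulVK.
case am : (a m); first exact: flipK.
move=> /clenV; rewrite cinvM cinvK.
(* When [a m] is false, the flipped sequence contains [l m], so the two sequences exchange roles. *)
have aE : a = flip_at m (flip_at m a).
  by apply/funext => i; rewrite /flip_at; case: eqP => // _; rewrite negbK.
rewrite {2}aE; apply: flipK.
by rewrite /flip_at eqxx am.
Qed.

(** Every clause passes to uniform limits along which the pairs converge too; for the last clause
    this is [pcomm_prod_limit]. *)
Definition comm_homotopy (n : nat) (p : cantor * cantor) (H : R * R -> X) : Prop :=
  [/\ cts_on unit_sq H,
      forall s, unit_I s -> H (s, 0) = quotient_loop p s,
      forall t, unit_I t -> H (0, t) = x /\ H (1, t) = x &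
      exists a b : nat -> loop, forall s, unit_I s -> H (s, 1) = pcomm_prod a b (iota 0 n) s].

Lemma comm_homotopyP n p : (exists H, comm_homotopy n p H) <-> clen n (cls (quotient_loop p)).
Proof.
split=> [[H [cH H0 Hx [a [b H1]]]]|/clen_ex_pcomm_prod/(_ 0%N)[a [b]]].
  rewrite -[n in clen n _](size_iota 0 n).
  suff -> : cls (quotient_loop p) = cls (pcomm_prod a b (iota 0 n)).
    exact: clen_pcomm_prod.
  apply/clsP; exists H; split; first exact/cts_onP.
    by move=> s Is; rewrite H0// H1.
  by move=> t It; rewrite !path0 !path1; exact: Hx.
move=> /clsP[H [cH H1 H2]]; exists H; split; first exact/cts_onP.
- by move=> s Is; have [] := H1 s Is.
- by move=> t /H2; rewrite path0 path1.
- by exists a, b => s Is; have [] := H1 s Is.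
Qed.

Context (net : nat -> seq X).
Context (netP : forall j y, exists2 c, c \in net j & d c y < shrink j / 2).

(** The first entry of the index bounds the commutator length; the later ones
    confine the homotopy to smaller and smaller balls around step functions,
    so that homotopies chosen along a branch form a uniformly Cauchy sequence. *)
Definition homotopy_scheme (u : seq nat) (p : cantor * cantor) : Prop :=
  if u is n :: v then exists H, comm_homotopy n p H /\
    forall j, (j < size v)%N -> forall q, unit_sq q ->
      d (H q) (step_fun x (net j) (nth 0%N v j) q) < shrink j
  else in_comm (cls (quotient_loop p)).

Lemma homotopy_scheme1 n p : homotopy_scheme [:: n] p <-> clen n (cls (quotient_loop p)).
Proof.
rewrite -comm_homotopyP; split=> [[H [HH _]]|[H HH]]; exists H => //.
Qed.

Lemma homotopy_scheme_split u p :
  homotopy_scheme u p -> exists k, homotopy_scheme (rcons u k) p.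
Proof.
case: u => [[n nc]|n v [H [HH Hv]]]; first by exists n; apply/homotopy_scheme1.
have [cH _ _ _] := HH.
have [k Hk] := step_fun_dense dX x (netP (size v)) cH.
exists k, H; split => // j; rewrite size_rcons ltnS leq_eqVlt => /orP[/eqP ->|jv] q Dq.
  by rewrite nth_rcons ltnn eqxx; exact: Hk.
by rewrite nth_rcons jv; exact: Hv.
Qed.

Lemma homotopy_scheme_limit n (f : nat -> nat) p :
  (forall j, exists q, [/\ homotopy_scheme (n :: mkseq f j) q,
     restr q.1 j = restr p.1 j & restr q.2 j = restr p.2 j]) -> homotopy_scheme [:: n] p.
Proof.
move=> Hj; apply/homotopy_scheme1/comm_homotopyP.
(* Length [j.+1] confines the [j]-th homotopy at every level up to [j] itself. For [i <= j], [K i]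
   and [K j] are thus within [shrink i] of one step function, whence the rate [2 * shrink i]. *)
have [q Hq] := choice (fun j => Hj j.+1).
have [K HK] := choice (fun j => let: And3 a _ _ := Hq j in a).
have KK i j s : (i <= j)%N -> unit_sq s -> d (K i s) (K j s) <= 2 * shrink i.
  move=> ij Ds.
  have := (HK i).2 i; rewrite size_mkseq ltnSn nth_mkseq ?ltnSn// => /(_ isT s Ds).
  have := (HK j).2 i; rewrite size_mkseq ltnS ij nth_mkseq ?ltnS// => /(_ isT s Ds).
  set c := step_fun _ _ _ _.
  by have := dT (K i s) c (K j s); rewrite (dC c (K j s)); lra.
have [H [cH HH]] := uniform_limit dX cX (ler0n R 2)
  (fun k => let: conj (And4 c _ _ _) _ := HK k in c) KK.
have I0 : unit_I (0 : R) := unit0; have I1 : unit_I (1 : R) := unit1.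
exists H; split => //.
(* Two units of error come from the limit of the homotopies and two from replacing [q k] by [p]. *)
- move=> s Is; apply: (metric_eq dX (ler0n R 4)) => k.
  have := HH k (s, 0) (conj Is I0); have [[_ -> // _ _] _] := HK k.
  have [_ q1 q2] := Hq k.
  have := quotient_loop_close q1 q2 Is; have := @shrink_mono R _ _ (leqnSn k).
  have := dT (H (s, 0)) (quotient_loop (q k) s) (quotient_loop p s).
  by rewrite (dC (H (s, 0)) (quotient_loop (q k) s)); lra.
- move=> t It; split; apply/esym/(metric_eq dX (ler0n R 2)) => k.
    have := HH k (0, t) (conj I0 It); have [[_ _ + _] _] := HK k.
    by move=> /(_ t It)[-> _].
  have := HH k (1, t) (conj I1 It); have [[_ _ + _] _] := HK k.
  by move=> /(_ t It)[_ ->].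
have abP k : exists ab : (nat -> loop) * (nat -> loop),
    forall s, unit_I s -> K k (s, 1) = pcomm_prod ab.1 ab.2 (iota 0 n) s.
  by have [[_ _ _ [a [b Hab]]] _] := HK k; exists (a, b).
have [ab Hab] := choice abP.
apply: (pcomm_prod_limit dX (ler0n R 2) (iota_uniq 0 n)
  (a := fun k => (ab k).1) (b := fun k => (ab k).2)).
  by apply: (cts_on_comp cH); [cts|move=> s Is].
by move=> k s Is; rewrite -Hab//; exact: HH.
Qed.

Context (conn : @path_connected_set R X [set: X]).
Context (H1small : @H1_card_lt_continuum R X).

Lemma small_loops_clen : exists n m, (n + n < m)%N /\ clen (n + n) (cls (l m)).
Proof.
have [M|nM] := pselect (meager_in (homotopy_scheme [::]) ([::], [::])).
  have [phi Hphi] := meager_perfect M; case: H1small.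
  exists (fun a => [:: (1, L (phi a) : R -> X)]); split=> [a|a b hab].
    split=> [e|y]; first by rewrite mem_seq1 => /eqP -> /=; apply/cts_onP/path_cts.
    by rewrite /bd1_coef big_seq1 /= path0 path1 subrr mulr0.
  apply: contrapT => /Hphi; apply => /=.
  by rewrite /homotopy_scheme cls_cat cls_rev; exact: homologous_in_comm hab.
have [n [c [D [dD HD]]]] := souslin_comeager homotopy_scheme_split homotopy_scheme_limit nM.
(* Beyond the first string of [c] the flip stays in [c]; above [n + n] the bound contradicts the
   choice of [l m]. *)
pose m := maxn (size c.1) (n + n).+1.
have [a [b [ha hb]]] := comeager_flip dD HD (leq_maxl _ _ : (size c.1 <= m)%N).
exists n, m; split; first exact: leq_maxr.
by apply: (@clen_flip a b); apply/homotopy_scheme1.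
Qed.

End SmallLoops.

(** * Change of base point and compactness *)

Section LocalToGlobal.
Context {R : realType} {X : topologicalType} (d : X -> X -> R).
Context (dX : compatible_metric d).
Context (pX : @peano_continuum R X).

Let cX : compact [set: X]. Proof. by case: pX. Qed.
Let dC y z : d y z = d z y. Proof. exact: dX.1.2.2.1. Qed.
Let dT y z w : d y w <= d y z + d z w. Proof. exact: dX.1.2.2.2. Qed.

(** Boundedness makes the supremum in [loop_diam] an actual upper bound. *)
Lemma metric_bounded (y : X) : exists M, forall z, d y z <= M.
Proof.
have [s Hs] := finite_net dX cX (@ltr01 R).
have [M HM] : exists M, forall c, c \in s -> d y c <= M.
  elim: s {Hs} => [|c s [M HM]]; first by exists 0.
  exists (Num.max (d y c) M) => e; rewrite inE => /orP[/eqP ->|/HM h].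
    by rewrite le_max lexx.
  by rewrite le_max h orbT.
exists (M + 1) => z; have [c /HM h1 h2] := Hs z.
by have := dT y c z; lra.
Qed.

Lemma loop_diam_lt (f : R -> X) e s t : loop_diam d f < e -> unit_I s -> unit_I t ->
  d (f s) (f t) < e.
Proof.
move=> fe Is It; apply: le_lt_trans fe; apply: ub_le_sup; last by exists s => //; exists t.
have [M HM] := metric_bounded (f 0).
exists (M + M) => _ [u _ [v _ <-]].
have := HM (f u); have := HM (f v); have := dT (f u) (f 0) (f v).
by rewrite (dC (f u) (f 0)); lra.
Qed.

(** A loop [q] at [y] near [x] is conjugated to [x] along a short path. The path and the base point
    account for one half of [shrink n], the loop for the other. Compactness then gives one [N] for
    all points. *)
Lemma comm_length_local :
  (forall x : X, exists n, forall l : @path_from_to R X x x,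
    (forall s, unit_I s -> d x (l s) <= shrink n) -> comm_length_le l n) ->
  exists N, forall (y : X) (q : @path_from_to R X y y),
    (forall s, unit_I s -> d y (q s) < shrink N) -> comm_length_le q N.
Proof.
move=> loc; have [_ _ lX] := pX.
have /compact_near_coveringP ncov := cX.
pose P N y := forall q : @path_from_to R X y y,
    (forall s, unit_I s -> d y (q s) < shrink N) -> comm_length_le q N.
have [x _|N _ HN] := ncov nat \oo P _; last by exists N => y; exact: (HN N (leqnn N)).
have [n Hn] := loc x.
have n2 : 0 < @shrink R n / 2 by have := @shrink_gt0 R n; lra.
have [V [oV Vx VB Vp]] : exists V : set X, [/\ open V, V x,
    V `<=` [set y | d x y < shrink n / 2] & @path_connected_set R X V].
  by apply: lX; apply/(nbhs_metric dX); exists (shrink n / 2).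
have [m Hm] := shrink_small n2.
exists (V, [set N | (maxn m n <= N)%N]) => /=.
  by split; [exact: open_nbhs_nbhs|exists (maxn m n)].
move=> [y N] /= [Vy mN] q Hq.
have [g [/cts_onP cg [g0 [g1 gV]]]] := Vp x y Vx Vy.
pose gam : path_from_to x y := Path (conj cg (conj g0 g1)).
have shrN : shrink N < @shrink R n / 2 by apply: Hm; apply: leq_trans mN; exact: leq_maxl.
have nN : (n <= N)%N by apply: leq_trans mN; exact: leq_maxr.
have /comm_length_leP[k kn ck] : comm_length_le (pcat gam (pcat q (preverse gam))) n.
  apply: Hn => s Is.
  apply: (@path_concat_ind R X (fun _ u _ => d x u <= shrink n)
    gam gam (pcat q (preverse gam)) (pcat q (preverse gam))) => // t It _.
    by have := VB _ (gV t It); rewrite /=; lra.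
  apply: (@path_concat_ind R X (fun _ u _ => d x u <= shrink n)
    q q (preverse gam) (preverse gam)) => // u Iu _.
    by have := Hq u Iu; have := VB _ Vy; have := dT x y (q u); rewrite /=; lra.
  have Iu' : unit_I (1 - u) by move: Iu; rewrite /unit_I /=; lra.
  by have := VB _ (gV _ Iu'); rewrite /= /path_rev; lra.
apply/comm_length_leP; exists k; first exact: leq_trans kn nN.
have := clen_conj (cinv (cls gam)) ck.
by rewrite !cls_cat cls_rev cinvK !cmulA cmulVc cmul1c cmulVK.
Qed.

End LocalToGlobal.

Theorem theorem3p2 (R : realType) (X : topologicalType) (d : X -> X -> R) :
  @peano_continuum R X ->
  compatible_metric d ->
  @H1_card_lt_continuum R X ->
  exists2 eps : R, 0 < eps &
    exists N : nat, forall l : R -> X,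
      is_path l -> l 0 = l 1 -> loop_diam d l < eps -> comm_length_le l N.
Proof.
move=> pX dX H1small; have [cX conn _] := pX.
have [|N HN] := comm_length_local dX pX; last first.
  exists (shrink N); first exact: shrink_gt0.
  exists N => l /cts_onP cl l01 dl.
  apply: (HN (l 0) (Path (conj cl (conj erefl (esym l01))))) => s Is /=.
  by apply: (loop_diam_lt dX pX dl) => //; exact: unit0.
move=> x; apply: contrapT => nloc.
have {nloc} bad n : exists l : @path_from_to R X x x,
    (forall s, unit_I s -> d x (l s) <= shrink n) /\ ~ comm_length_le l n.
  apply: contrapT => nb; apply: nloc; exists n => l sl.
  by apply: contrapT => nl; apply: nb; exists l.
have [l Hl] := choice bad.
have sl : small_loops d l by move=> k; exact: (Hl k).1.
have [L HL] := choice (fun a => inf_concat_ex dX cX (select_small dX sl a)).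
have netP j : exists z : seq X, forall y, exists2 c, c \in z & d c y < shrink j / 2.
  by apply: (finite_net dX cX); have := @shrink_gt0 R j; lra.
have [net Hnet] := choice netP.
have [n [m [nm cm]]] := small_loops_clen dX cX sl HL Hnet conn H1small.
apply: (Hl m).2; apply/comm_length_leP; exists (n + n)%N => //; exact: ltnW.
Qed.
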